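(* Let $\mu\in(0,\tfrac12]$ and let $(\bm{\eta}_t)_{t\ge 0}=\big((\eta_t(v))_{v\in\mathbb{Z}}\big)_{t\ge0}$ be the compass model on $\mathbb{Z}$ with parameter $\mu$, started from $(\eta_0(v))_{v\in\mathbb{Z}}$ i.i.d. uniformly distributed on $\mathcal{S}=(-1,1]$. Then, as $t\to\infty$, the distribution of $\bm{\eta}_t$ converges weakly (on $\mathcal{S}^{\mathbb{Z}}$ with the product topology) to $\frac12\int_{-1}^{1}\delta_{\bar s}\,ds$, the uniform mixture over $s\in\mathcal{S}$ of the Dirac measures $\delta_{\bar s}$.
   Context: Opinion space: $\mathcal{S}=\mathbb{R}/2\mathbb{Z}$ (a circle of perimeter 2), identified with $(-1,1]$ by unique representatives; ''$x \pmod{\mathcal{S}}$'' denotes the representative of $x$ in $(-1,1]$. The metric is $d(x,y)=\min\{|x-y|,\,2-|x-y|\}$ for $x,y\in(-1,1]$, and $\mathcal{S}$ carries the corresponding circle topology. Compass model on $\mathbb{Z}$ with parameter $\mu\in(0,\tfrac12]$: the graph has vertex set $\mathbb{Z}$ and edges $e_v=\langle v,v+1\rangle$, $v\in\mathbb{Z}$. The state space is $\mathcal{S}^{\mathbb{Z}}$ with the product topology. The edges carry independent Poisson processes of rate 1, independent of the initial configuration $\bm{\eta}_0$. When the Poisson process of an edge $\langle u,v\rangle$ has an event at time $t$, only the opinions at $u$ and $v$ change: let $\delta\in(-1,1]$ be the representative of $\eta_{t-}(v)-\eta_{t-}(u)$. If $\delta\neq 1$, set $\sigma=\delta$; if $\delta=1$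 (diametrically opposed opinions), let $\sigma\in\{-1,+1\}$ be chosen uniformly at random, independently of everything else. Then $\eta_t(u)=\eta_{t-}(u)+\mu\sigma \pmod{\mathcal{S}}$ and $\eta_t(v)=\eta_{t-}(v)-\mu\sigma\pmod{\mathcal{S}}$. For $s\in\mathcal{S}$, $\bar s\in\mathcal{S}^{\mathbb{Z}}$ is the constant configuration with value $s$ at all vertices, and $\delta_{\bar s}$ is the Dirac measure at $\bar s$. *)

(* Defs.v *)
From HB Require Import structures.
From mathcomp Require Import all_boot all_order all_algebra.
From mathcomp Require Import archimedean finmap ring lra.
From mathcomp Require Import all_classical all_reals all_analysis.
From mathcomp Require Import measurable_realfun.

Set Implicit Arguments.
Unset Strict Implicit.
Unset Printing Implicit Defensive.

Import Order.TTheory GRing.Theory Num.Theory.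
Import numFieldNormedType.Exports.

Local Open Scope classical_set_scope.
Local Open Scope ring_scope.

Record circle (R : realType) := Circle {
  circle_val :> R ;
  circle_valP : -1 < circle_val <= 1 }.

HB.instance Definition _ (R : realType) := [isSub for @circle_val R].
HB.instance Definition _ (R : realType) := [Choice of circle R by <:].

(* The representative of x modulo 2 in (-1, 1]: ceil ((x - 1) / 2) is the only
   integer k with -1 < x - 2 k <= 1. *)
Definition circle_rep (R : realType) (x : R) : R :=
  x - 2 * (Num.ceil ((x - 1) / 2))%:~R.

Lemma circle_repP (R : realType) (x : R) : -1 < circle_rep x <= 1.
Proof.
rewrite /circle_rep.
have h1 := ceil_ge ((x - 1) / 2).
have h2 := ceilB1_lt ((x - 1) / 2).
rewrite intrB in h2.
by apply/andP; split; lra.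
Qed.

Definition circle_of (R : realType) (x : R) : circle R :=
  Circle (circle_repP x).

HB.instance Definition _ (R : realType) := isPointed.Build (circle R) (circle_of 0).

Definition circle_dist (R : realType) (x y : circle R) : R :=
  Num.min `|circle_val x - circle_val y| (2 - `|circle_val x - circle_val y|).

Lemma circle_distxx (R : realType) (x : circle R) : circle_dist x x = 0.
Proof. by rewrite /circle_dist subrr normr0 subr0 min_l. Qed.

Lemma circle_dist_eq0 (R : realType) (x y : circle R) :
  circle_dist x y = 0 -> x = y.
Proof.
move=> h; apply: val_inj => /=; move: h; rewrite /circle_dist.
case: x y => [x /andP[x1 x2]] [y /andP[y1 y2]] /=.
rewrite minEle; case: ifPn => _; first by move/eqP; rewrite normr_eq0 subr_eq0 => /eqP.
by case: (ger0P (x - y)) => h1 h2; lra.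
Qed.

Lemma circle_distC (R : realType) (x y : circle R) :
  circle_dist x y = circle_dist y x.
Proof. by rewrite /circle_dist distrC. Qed.

Lemma circle_dist_triangle (R : realType) (y x z : circle R) :
  circle_dist x z <= circle_dist x y + circle_dist y z.
Proof.
rewrite /circle_dist.
case: x y z => [x /andP[x1 x2]] [y /andP[y1 y2]] [z /andP[z1 z2]] /=.
have xz := ler_distD y x z; have xy := ler_distD z x y.
have yz := ler_distD x y z.
have xyz : `|x - y| + `|y - z| + `|x - z| <= 4.
  by case: (ger0P (x - y)) => ?; case: (ger0P (y - z)) => ?;
    case: (ger0P (x - z)) => ?; lra.
move: xz xy yz; rewrite (distrC z y) (distrC y x) => xz xy yz.
rewrite ge_min ![Num.min _ _]minEle.
move: `|x - y| `|y - z| `|x - z| xyz xz xy yz => a b c xyz xz xy yz.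
by case: ifPn => _; case: ifPn => _; apply/orP; [left|right|right|left]; lra.
Qed.

HB.instance Definition _ (R : realType) := isMetric.Build R (circle R)
  (@circle_distxx R) (@circle_dist_eq0 R) (@circle_distC R)
  (@circle_dist_triangle R).

Lemma circle_dist_of (R : realType) (x y : R) :
  circle_dist (circle_of x) (circle_of y) <= `|x - y|.
Proof.
rewrite /circle_dist /=; have := circle_repP x; have := circle_repP y.
rewrite /circle_rep.
move: (Num.ceil ((x - 1) / 2)) (Num.ceil ((y - 1) / 2)) => k l.
move=> /andP[y1 y2] /andP[x1 x2].
have [lk|kl|->] := ltgtP l k.
- have : (l + 1)%:~R <= k%:~R :> R by rewrite ler_int lezD1.
  rewrite intrD; move: l%:~R k%:~R y1 y2 x1 x2 => L K y1 y2 x1 x2 h.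
  rewrite ge_min; apply/orP; right.
  by case: (ger0P (x - y)) => ?;
    case: (ger0P (x - 2 * K - (y - 2 * L))) => ?; lra.
- have : (k + 1)%:~R <= l%:~R :> R by rewrite ler_int lezD1.
  rewrite intrD; move: l%:~R k%:~R y1 y2 x1 x2 => L K y1 y2 x1 x2 h.
  rewrite ge_min; apply/orP; right.
  by case: (ger0P (x - y)) => ?;
    case: (ger0P (x - 2 * K - (y - 2 * L))) => ?; lra.
- by rewrite opprB addrA subrK ge_min lexx.
Qed.

Lemma continuous_circle_of (R : realType) : continuous (@circle_of R).
Proof.
move=> x; apply/cvg_ballP => e e0; near=> y.
rewrite ballEmdist /=; apply: (le_lt_trans (circle_dist_of x y)).
by near: y; apply/nbhs_ballP; exists e.
Unshelve. all: by end_near. Qed.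

Definition borel (T : ptopologicalType) := g_sigma_algebraType (@open T).

Definition weak_cvg (R : realType) (T : ptopologicalType) (I : Type)
    (F : set_system I) (nu : I -> probability (borel T) R)
    (nu_lim : probability (borel T) R) : Prop :=
  forall f : T -> R, continuous f -> bounded_fun f ->
    (\int[nu i]_x (f x)%:E)%E @[i --> F] --> (\int[nu_lim]_x (f x)%:E)%E.

Definition config (R : realType) := {ptws int -> circle R}.

HB.instance Definition _ (R : realType) :=
  Topological.copy (config R) {ptws int -> circle R}.
HB.instance Definition _ (R : realType) :=
  isPointed.Build (config R) (fun=> circle_of 0).

Definition const_config (R : realType) (s : R) : config R :=
  fun=> circle_of s.

Lemma continuous_const_config (R : realType) : continuous (@const_config R).
Proof.
move=> s; apply/cvg_sup => v; move: s.
apply/(@continuousP _ (initial_topology (@^~ v))) => _ [B oB <-].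
have -> : @const_config R @^-1` (@^~ v @^-1` B) = @circle_of R @^-1` B by [].
by apply: open_comp => // x _; exact: continuous_circle_of.
Qed.

Lemma measurable_const_config (R : realType) :
  measurable_fun [set: R] (@const_config R : R -> borel (config R)).
Proof.
apply: (@measurability _ _ _ (borel (config R)) setT
  (@const_config R) (@open (config R))) => // _ [B oB <-].
rewrite setTI; apply: open_measurable.
by apply: open_comp => // x _; exact: continuous_const_config.
Qed.

(* (1/2) \int_{-1}^{1} delta_{\bar s} ds *)
Definition consensus_mixture (R : realType) (A : set (borel (config R))) :
    \bar R :=
  (2^-1%:E *
    \int[lebesgue_measure]_(s in `](-1)%R, 1%R]%classic)
      \d_(const_config s : borel (config R)) A)%E.

Section consensus_mixture_probability.
Context (R : realType).
Local Open Scope ereal_scope.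
Local Notation nu := (@consensus_mixture R).

Let measurable_integrand (A : set (borel (config R))) : measurable A ->
  measurable_fun (`](-1)%R, 1%R]%classic : set R)
    (fun s : R => \d_(const_config s : borel (config R)) A : \bar R).
Proof.
move=> mA; apply: measurable_funTS.
apply: (measurableT_comp (measurable_fun_dirac mA)).
exact: measurable_const_config.
Qed.

Let consensus_mixture0 : nu set0 = 0.
Proof. by rewrite /nu; under eq_integral do rewrite dirac0; rewrite integral0 mule0. Qed.

Let consensus_mixture_ge0 A : 0 <= nu A.
Proof. by rewrite mule_ge0 ?lee_fin ?invr_ge0//; exact: integral_ge0. Qed.

Let consensus_mixture_sigma_additive : semi_sigma_additive nu.
Proof.
move=> F mF tF mUF; rewrite [X in _ --> X](_ : _ = \sum_(n <oo) nu (F n)).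
  by apply: is_cvg_ereal_nneg_natsum => n _.
rewrite /nu nneseriesZl//; last by move=> n _; exact: integral_ge0.
congr (_ * _); rewrite -integral_nneseries//; last first.
  by move=> n; exact: measurable_integrand.
apply: eq_integral => s _.
by apply/esym/cvg_lim => //; exact: measure_semi_sigma_additive.
Qed.

HB.instance Definition _ := isMeasure.Build _ _ _ nu
  consensus_mixture0 consensus_mixture_ge0 consensus_mixture_sigma_additive.

Let consensus_mixtureT : nu setT = 1.
Proof.
rewrite /nu; under eq_integral do rewrite diracT.
rewrite integral_cst//= mul1e lebesgue_measure_itv/= lte_fin ifT; last by lra.
by rewrite -EFinB -EFinM; congr EFin; lra.
Qed.

HB.instance Definition _ := Measure_isProbability.Build _ _ _ nu
  consensus_mixtureT.

End consensus_mixture_probability.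

Definition sigma_of d d' (Omega : measurableType d) (T : measurableType d')
    (X : Omega -> T) : set_system Omega :=
  preimage_set_system setT X measurable.

Definition mutual_indep d (Omega : measurableType d) (R : realType)
    (P : probability Omega R) (I : choiceType) (F : I -> set_system Omega) :
    Prop :=
  forall (J : {fset I}) (A : I -> set Omega),
    (forall i, i \in J -> F i (A i)) ->
    P (\bigcap_(i in [set` J]) A i) = (\prod_(i <- J) P (A i))%E.

(* Times t < 0 are in the index set but are left unconstrained. *)
Record poisson_process d (Omega : measurableType d) (R : realType)
    (P : probability Omega R) (rate : R) (N : R -> {RV P >-> nat}) : Prop := {
  poisson_path : {ae P, forall w,
    [/\ N 0 w = 0%N,
        forall s t, 0 <= s -> s <= t -> (N s w <= N t w)%N &
        forall t, 0 <= t -> N s w @[s --> t^'+] --> N t w]} ;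
  poisson_increment : forall s t k, 0 <= s -> s < t ->
    P [set w | (N t w - N s w)%N = k] = (poisson_pmf (rate * (t - s)) k)%:E ;
  poisson_indep : forall t : nat -> R, 0 <= t 0%N -> nondecreasing_seq t ->
    mutual_indep P (fun k : nat =>
      sigma_of (fun w => (N (t k.+1) w - N (t k) w)%N)) }.

Definition sigma_of_process d (Omega : measurableType d) (R : realType)
    (P : probability Omega R) (N : R -> {RV P >-> nat}) : set_system Omega :=
  <<s \bigcup_(t in `[0, +oo[) sigma_of (N t) >>.

(* The edge <v, v + 1> is indexed by v. *)

(* Meant for nondecreasing n. *)
Definition jumps_at (R : realType) (n : R -> nat) (t : R) : Prop :=
  0 < t /\ forall s, 0 <= s -> s < t -> (n s < n t)%N.

(* The sigma of the update rule; the coin b breaks the tie delta = 1. *)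
Definition step (R : realType) (b : bool) (u v : circle R) : R :=
  let delta := circle_rep (circle_val v - circle_val u) in
  if delta == 1 then (if b then 1 else -1) else delta.

(* Path of the model for one realization: n v t is the number of events of the
   edge v in [0, t] and b v k the coin attached to its k-th event, k >= 1. *)
Record compass_path (R : realType) (mu : R) (n : int -> R -> nat)
    (b : int -> nat -> bool) (eta : R -> int -> circle R) : Prop := {
  compass_const : forall v s t, 0 <= s -> s <= t ->
    n (v - 1) s = n (v - 1) t -> n v s = n v t -> eta t v = eta s v ;
  compass_jump : forall v t, jumps_at (n v) t ->
    let x := lim (eta s v @[s --> t^'-]) in
    let y := lim (eta s (v + 1) @[s --> t^'-]) in
    let sigma := step (b v (n v t)) x y in
    eta t v = circle_of (circle_val x + mu * sigma) /\
    eta t (v + 1) = circle_of (circle_val y - mu * sigma) }.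

(* The initial configuration is a single source: independence of its coordinates
   is not part of the model. *)
Definition driving_sigma d (Omega : measurableType d) (R : realType)
    (P : probability Omega R) (N : int -> R -> {RV P >-> nat})
    (b : int -> nat -> {RV P >-> bool}) (eta0 : {RV P >-> borel (config R)})
    (i : unit + int + int * nat) : set_system Omega :=
  match i with
  | inl (inl _) => sigma_of eta0
  | inl (inr v) => sigma_of_process (N v)
  | inr (v, k) => sigma_of (b v k)
  end.

Record compass_model d (Omega : measurableType d) (R : realType)
    (P : probability Omega R) (mu : R) (N : int -> R -> {RV P >-> nat})
    (b : int -> nat -> {RV P >-> bool})
    (eta : R -> {RV P >-> borel (config R)}) : Prop := {
  compass_clocks : forall v, poisson_process 1 (N v) ;
  compass_coins : forall v k, P [set w | b v k w = true] = (2^-1)%:E ;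
  compass_indep : mutual_indep P (driving_sigma N b (eta 0)) ;
  compass_paths : {ae P, forall w,
    compass_path mu (fun v t => N v t w) (fun v k => b v k w)
      (fun t => eta t w)} }.

Definition iid_uniform d (Omega : measurableType d) (R : realType)
    (P : probability Omega R) (xi : Omega -> config R) : Prop :=
  mutual_indep P (fun v : int =>
    sigma_of (fun w => xi w v : borel (circle R))) /\
  forall (v : int) (A : set R), measurable A ->
    P [set w | A (circle_val (xi w v))] =
    (2^-1%:E * lebesgue_measure (A `&` `](-1)%R, 1%R]))%E.

(* Main.v *)
(* Let m_t(u) be the distance between the opinions at u and u + 1. A ring of the
   edge x replaces m(x) by (1 - 2 mu) m(x) and raises m(x - 1) and m(x + 1) by at
   most mu m(x), so m is dominated by the linear dynamics [push], in which a
   site gives the proportion mu of its mass to each neighbour; moreover m never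
   exceeds 1. The expected linear dynamics does not increase a constant profile,
   whereas, for every n, there is a finite sequence of rings of the edges
   1, ..., n after which it would put mass at least n / 2 on site 0. This
   sequence has positive probability p during a unit of time, and then
   m(0) <= 1. If the expected distances are at most a, they are therefore at
   most a + p (1 - a n / 2) one unit of time later, and they tend to 0 since n
   is arbitrary. The bound involves neither the configuration nor the coins, so
   only the clocks matter; to get finite sums, time is cut into steps of length
   1 / k, only the edges of a window are observed, and the patterns with at most
   one ring of the window per step carry all but a vanishing part of the
   probability. The boundary of the window is absorbed by a small parabola.

   On the event that some edge on each side of 0 does not ring before time t, a
   pattern determines the opinion at 0 as a function of eta_0 that commutes with
   rotations, so its law is uniform. Near consensus at uniformly distributed
   values gives the weak limit, because a continuous function is uniformly
   continuous along the compact set of constant configurations. *)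
Require Import Defs.
From HB Require Import structures.
From mathcomp Require Import all_boot all_order all_algebra.
From mathcomp Require Import archimedean finmap ring lra zify.
From mathcomp Require Import all_classical all_reals all_analysis.
From mathcomp Require Import measurable_realfun.

Set Implicit Arguments.
Unset Strict Implicit.
Unset Printing Implicit Defensive.

Import Order.TTheory GRing.Theory Num.Theory.
Import numFieldNormedType.Exports.

Local Open Scope classical_set_scope.
Local Open Scope ring_scope.

(** * The linear dynamics that dominates the distances of neighbours *)

Section transfer.
Context (R : realType) (mu : R).
Implicit Types (x u v : int) (f g : int -> R).

(* Bound for the distances of neighbours after a ring of the edge x, in terms of
   the distances f before it. *)
Definition push x f : int -> R := fun u =>
  f u + mu * f x * ((u == x + 1)%:R + (u == x - 1)%:R - 2 * (u == x)%:R).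

Lemma push_id x f : push x f x = (1 - 2 * mu) * f x.
Proof.
rewrite /push eqxx.
have -> : (x == x + 1) = false by lia.
have -> : (x == x - 1) = false by lia.
rewrite /=; ring.
Qed.

Lemma push_left x f : push x f (x - 1) = f (x - 1) + mu * f x.
Proof.
rewrite /push eqxx.
have -> : (x - 1 == x + 1) = false by lia.
have -> : (x - 1 == x) = false by lia.
rewrite /=; ring.
Qed.

Lemma push_right x f : push x f (x + 1) = f (x + 1) + mu * f x.
Proof.
rewrite /push eqxx.
have -> : (x + 1 == x - 1) = false by lia.
have -> : (x + 1 == x) = false by lia.
rewrite /=; ring.
Qed.

Lemma push_far x f u : u != x -> u != x + 1 -> u != x - 1 -> push x f u = f u.
Proof. by rewrite /push => /negPf-> /negPf-> /negPf->; rewrite /=; ring. Qed.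

(** A site loses mass, receives some or is untouched. The relation is binary so that one case
    analysis serves both comparison and, ignoring [g], positivity. *)
Lemma push_ind (P : R -> R -> Prop) x f g u :
  P ((1 - 2 * mu) * f u) ((1 - 2 * mu) * g u) ->
  P (f u + mu * f x) (g u + mu * g x) ->
  P (f u) (g u) -> P (push x f u) (push x g u).
Proof.
move=> h1 h2 h3.
have [->|nx] := eqVneq x u; first by rewrite !push_id.
have [e|n1] := eqVneq u (x + 1); first by move: h2; rewrite e !push_right.
have [e|n2] := eqVneq u (x - 1); first by move: h2; rewrite e !push_left.
by rewrite !push_far// eq_sym.
Qed.

Lemma push_sum (I : Type) (s : seq I) (a : I -> R) (F : I -> int -> R) x u :
  push x (fun w => \sum_(i <- s) a i * F i w) u =
  \sum_(i <- s) a i * push x (F i) u.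
Proof.
rewrite /push mulr_sumr mulr_suml -big_split/=; apply: eq_bigr => i _; ring.
Qed.

Lemma push_shift x f u v : push (v + x) f (v + u) = push x (fun w => f (v + w)) u.
Proof.
rewrite /push; congr (_ + _ * (_%:R + _%:R - _ * _%:R)); lia.
Qed.

Definition pushes (s : seq int) f : int -> R := foldl (fun f x => push x f) f s.

Lemma pushes_rcons s x f : pushes (rcons s x) f = push x (pushes s f).
Proof. by rewrite /pushes -cats1 foldl_cat. Qed.

Lemma pushes_shift s f u v :
  pushes [seq v + x | x <- s] f (v + u) = pushes s (fun w => f (v + w)) u.
Proof.
elim/last_ind: s u => [//|s x IH] u.
rewrite map_rcons !pushes_rcons push_shift /push; congr (_ + mu * _ * _); exact: IH.
Qed.

(** Summation by parts: a push changes a weighted sum by the second difference of the weights at the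
    pushed site. With [i < n] that site and both its neighbours lie in 0, ..., n + 1, so no mass
    leaves the sum. *)
Lemma sum_push (n : nat) (c : nat -> R) f (i : nat) : (i < n)%N ->
  \sum_(j < n.+2) c j * push i.+1 f j =
  \sum_(j < n.+2) c j * f j + mu * f i.+1 * (c i.+2 + c i - 2 * c i.+1).
Proof.
move=> ltin.
have single (k : nat) : (k < n.+2)%N -> \sum_(j < n.+2) c j * ((j : nat) == k)%:R = c k.
  move=> hk; rewrite (bigD1 (Ordinal hk))//= eqxx mulr1 big1 ?addr0// => j /negPf.
  by rewrite -val_eqE /= => ->; rewrite mulr0.
rewrite -[c i.+2](single i.+2) ?ltnS// -[c i](single i); last by lia.
rewrite -[c i.+1](single i.+1); last by lia.
rewrite mulr_sumr -big_split/= -sumrB mulr_sumr -big_split/=.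
apply: eq_bigr => j _; rewrite /push.
have -> : (Posz j == i.+1%:Z + 1) = (j == i.+2 :> nat) by lia.
have -> : (Posz j == i.+1%:Z - 1) = (j == i :> nat) by lia.
have -> : (Posz j == i.+1%:Z) = (j == i.+1 :> nat) by lia.
rewrite /=; ring.
Qed.

Hypotheses (mu_ge0 : 0 <= mu) (mu_le : mu <= 2^-1).

Let one_sub2mu_ge0 : 0 <= 1 - 2 * mu.
Proof. by move: mu_le => ?; lra. Qed.

Lemma push_mono x f g u : f x <= g x -> f u <= g u -> push x f u <= push x g u.
Proof.
move=> hx hu; apply: (push_ind (P := fun a b => a <= b)) => //.
  by rewrite ler_wpM2l.
by rewrite lerD// ler_wpM2l.
Qed.

Lemma push_ge0 x f : (forall u, 0 <= f u) -> forall u, 0 <= push x f u.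
Proof.
move=> f0 u; apply: (push_ind (P := fun a _ => 0 <= a)) => //.
  by rewrite mulr_ge0.
by rewrite addr_ge0// mulr_ge0.
Qed.

Lemma pushes_ge0 s f : (forall u, 0 <= f u) -> forall u, 0 <= pushes s f u.
Proof. by move=> f0; elim/last_ind: s => [//|s x IH] u; rewrite pushes_rcons; exact: push_ge0. Qed.

End transfer.

(** * Concentration of mass on one site by finitely many pushes *)

Section concentration.
Context (R : realType) (mu : R) (mu_gt0 : 0 < mu) (mu_le : mu <= 2^-1).
Variable n : nat.

Let inside (x : int) := (1 <= x <= n%:Z)%R.
Let quad (m : int -> R) := \sum_(j < n.+2) (j%:R * (n.+1%:R - j%:R)) * m j.
Let lever (m : int -> R) := \sum_(j < n.+2) (n.+1%:R - j%:R) * m j.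

(** Greedy choice with a potential: the weights j (n + 1 - j) of [quad] have second difference -2,
    so a push from a site with mass above [eta] lowers [quad] by more than [d]. As [quad] stays
    nonnegative, this happens only finitely often. *)
Lemma pushes_dissipate (eta : R) : 0 < eta ->
  exists2 s : seq int, all inside s &
    forall i, (i < n)%N -> pushes mu s (fun=> 1) i.+1 <= eta.
Proof.
move=> eta0.
pose d := 2 * mu * eta.
have d0 : 0 < d by rewrite !mulr_gt0.
suff H (N : nat) (s : seq int) : all inside s ->
    quad (pushes mu s (fun=> 1)) < d * N%:R ->
    exists2 s : seq int, all inside s &
    forall i, (i < n)%N -> pushes mu s (fun=> 1) i.+1 <= eta.
  pose N := Num.truncn (quad (pushes mu [::] (fun=> 1)) / d).
  apply: (H N.+1 [::]) => //.
  rewrite mulrC -ltr_pdivrMr//; exact: truncnS_gt.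
elim: N s => [|N IH] s sin.
  rewrite mulr0 ltNge => /negP[]; apply: sumr_ge0 => j _.
  apply: mulr_ge0; last by apply: pushes_ge0 => //; exact: ltW.
  by apply: mulr_ge0 => //; rewrite subr_ge0 ler_nat -ltnS.
move=> qN.
have [[i [ltin big]]|no] := pselect (exists i, (i < n)%N /\ eta < pushes mu s (fun=> 1) i.+1).
  apply: (IH (rcons s i.+1)).
    by rewrite all_rcons sin andbT /inside; lia.
  rewrite /quad pushes_rcons (@sum_push R mu n (fun j => j%:R * (n.+1%:R - j%:R)) _ i)//.
  rewrite -/(quad _).
  set m := pushes _ _ _ _ in big *.
  have -> : i.+2%:R * (n.+1%:R - i.+2%:R) + i%:R * (n.+1%:R - i%:R)
     - 2 * (i.+1%:R * (n.+1%:R - i.+1%:R)) = - 2 :> R.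
    by rewrite -[i.+2]addn2 -[i.+1]addn1 !natrD; ring.
  have : mu * eta < mu * m by rewrite ltr_pM2l.
  by rewrite /d in qN *; rewrite -natr1 in qN; lra.
exists s => // i ltin; rewrite leNgt; apply/negP => h; apply: no; exists i; split => //.
Qed.

Lemma lever_push m i : (i < n)%N -> lever (push mu i.+1 m) = lever m.
Proof.
move=> ltin; rewrite /lever (@sum_push R mu n (fun j => n.+1%:R - j%:R) _ i)//.
rewrite (_ : _ - 2 * _ = 0) ?mulr0 ?addr0//.
by rewrite -[i.+2]addn2 -[i.+1]addn1 !natrD; ring.
Qed.

Lemma lever_pushes s m : all inside s -> lever (pushes mu s m) = lever m.
Proof.
elim/last_ind: s => [//|s x IH]; rewrite all_rcons => /andP[/andP[x1 xn] /IH <-].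
rewrite pushes_rcons (_ : x = (`|x|.-1).+1%:Z) ?lever_push//; lia.
Qed.

(* Pushing from the sites 1..n empties them; the lever rule, an invariant of
   these moves, then forces about half of their mass onto site 0. *)
Lemma pushes_concentrate :
  exists2 s : seq int, all inside s & n%:R / 2 <= pushes mu s (fun=> 1) 0.
Proof.
have [n0|n_gt0] := posnP n; first by exists [::] => //; rewrite n0 /pushes/=; lra.
(* Each of the sites 1, ..., n has lever arm at most n + 1, so this threshold leaves them a total
   lever of at most 1. *)
pose eta : R := (n%:R * n.+1%:R)^-1.
have eta0 : 0 < eta by rewrite invr_gt0 mulr_gt0// ltr0n.
have [s sin small] := pushes_dissipate eta0.
exists s => //.
have := @lever_pushes s (fun=> 1) sin.
rewrite /lever big_ord_recl /= subr0 => h.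
have h2 : \sum_(i < n.+1) (n.+1%:R - (bump 0 i)%:R) * pushes mu s (fun=> 1) (bump 0 i) <= 1.
  (* The arm at site n + 1 is 0, so the mass received there does not count. *)
  rewrite big_ord_recr/= [X in _ + X * _](_ : _ = 0) ?mul0r ?addr0; last first.
    by rewrite /bump /= add1n subrr.
  apply: (@le_trans _ _ (\sum_(i < n) (n.+1%:R * eta))).
    apply: ler_sum => i _; apply: ler_pM.
    - by rewrite subr_ge0 ler_nat /bump /= add1n; have := ltn_ord i; lia.
    - by apply: pushes_ge0 => //; exact: ltW.
    - by rewrite lerBlDr lerDl.
    - by rewrite /bump /= add1n; exact: small.
  rewrite sumr_const card_ord -[X in X <= _]mulr_natl mulrA /eta divff// mulf_neq0//.
  by rewrite pnatr_eq0 -lt0n.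
have h3 : \sum_(j < n.+2) (n.+1%:R - j%:R) * 1 = n.+1%:R * n.+2%:R / 2 :> R.
  have : \sum_(j < n.+2) (n.+1%:R - j%:R) * 1 = \sum_(j < n.+2) j%:R :> R.
    rewrite (reindex_inj rev_ord_inj)/=; apply: eq_bigr => j _.
    by rewrite mulr1 subSS natrB ?subKr// -ltnS.
  have e : \sum_(j < n.+2) (n.+1%:R - j%:R) * 1 + \sum_(j < n.+2) j%:R = n.+2%:R * n.+1%:R :> R.
    rewrite -big_split/= (eq_bigr (fun=> n.+1%:R)).
      by rewrite sumr_const card_ord -[LHS]mulr_natl.
    by move=> j _; rewrite mulr1 subrK.
  lra.
rewrite h3 in h.
(* Site 0 has arm n + 1; dividing by it leaves (n + 2) / 2 - 1 = n / 2. *)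
have h4 : n.+1%:R * (n.+2%:R / 2 - 1) <= n.+1%:R * pushes mu s (fun=> 1) 0.
  have : 1 <= n.+1%:R :> R by rewrite ler1n.
  move: h h2; set S := \sum_(i < n.+1) _; set p := pushes _ _ _ _ => h h2 h1.
  have -> : n.+1%:R * p = n.+1%:R * n.+2%:R / 2 - S by rewrite -h addrK.
  rewrite mulrBr mulr1 mulrA lerD2l lerN2; exact: le_trans h1.
rewrite ler_pM2l ?ltr0n// in h4; apply: le_trans h4.
rewrite -[n.+2]addn2 natrD mulrDl divff ?addrK//.
Qed.

End concentration.

(** * Patterns of rings *)

(** The radius is r + 1 because, when |u| < r, the change of the distance at u involves the edges u
    - 2, ..., u + 2. *)
Definition window (r : nat) : seq int := [seq i%:Z - r.+1%:Z | i <- iota 0 (2 * r + 3)].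

Lemma mem_window r x : (x \in window r) = (`|x| <= r.+1%:Z).
Proof.
apply/mapP/idP => [[i]|hx].
  by rewrite mem_iota => hi ->; lia.
by exists (absz (x + r.+1%:Z)); [rewrite mem_iota; lia|lia].
Qed.

Lemma uniq_window r : uniq (window r).
Proof. by rewrite map_inj_uniq ?iota_uniq// => i j; lia. Qed.

Lemma size_window r : size (window r) = (2 * r + 3)%N.
Proof. by rewrite size_map size_iota. Qed.

Definition letters (r : nat) : seq (option int) := None :: map Some (window r).

Lemma uniq_letters r : uniq (letters r).
Proof.
rewrite /= map_inj_uniq ?uniq_window ?andbT; last by move=> ? ? [].
by apply/mapP => -[].
Qed.

Fixpoint patterns (r k : nat) : seq (seq (option int)) :=
  if k is k'.+1 then [seq o :: xs | o <- letters r, xs <- patterns r k']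
  else [:: [::]].

Lemma patternsS r k :
  patterns r k.+1 = [seq o :: xs | o <- letters r, xs <- patterns r k].
Proof. by []. Qed.

Lemma patternsP r k xs :
  (xs \in patterns r k) = (size xs == k) && all (mem (letters r)) xs.
Proof.
elim: k xs => [|k IH] xs; first by rewrite inE; case: xs.
apply/allpairsP/andP => [[[a ys]/= [ho hy ->]]|[]].
  by move: hy; rewrite IH /= eqSS => /andP[-> ->]; rewrite andbT; split.
by case: xs => // o ys /=; rewrite eqSS => sy /andP[ho hy]; exists (o, ys); rewrite IH sy.
Qed.

Lemma uniq_patterns r k : uniq (patterns r k).
Proof.
elim: k => // k IH; apply: allpairs_uniq => //; first exact: uniq_letters.
by move=> [a xs] [c ys] /= _ _ [-> ->].
Qed.

(** A supersolution of the averaged dynamics, up to a constant drift: its second difference is the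
    constant 2 b. For b > 0 it exceeds 1 far from 0, which takes care of the boundary of the
    window. *)
Definition parabola (R : realType) (a b : R) (u : int) : R := a + b * u%:~R ^+ 2.

(** * Averages over patterns with at most one ring per step *)

Section average.
Context (R : realType) (r : nat) (q tau : R).

(* In a step of length tau, [None] stands for no ring in the window and [Some x]
   for a single ring, at x; q is the probability of [None]. *)
Definition weight (o : option int) : R := if o is Some _ then q * tau else q.

Definition pattern_weight (xs : seq (option int)) : R := \prod_(o <- xs) weight o.

(** An expectation restricted to the listed patterns: steps with several rings in the window are
    left out, so the total weight may be below 1. *)
Definition average k (F : seq (option int) -> R) : R :=
  \sum_(xs <- patterns r k) pattern_weight xs * F xs.

Lemma average0 F : average 0 F = F [::].
Proof. by rewrite /average big_seq1 /pattern_weight big_nil mul1r. Qed.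

Lemma averageS k F : average k.+1 F =
  \sum_(o <- letters r) weight o * average k (fun xs => F (o :: xs)).
Proof.
rewrite /average patternsS big_allpairs_dep; apply: eq_bigr => o _.
rewrite mulr_sumr; apply: eq_bigr => xs _.
by rewrite /pattern_weight big_cons mulrA.
Qed.

Lemma averageD j k F :
  average (j + k) F = average j (fun xs => average k (fun ys => F (xs ++ ys))).
Proof.
elim: j F => [|j IH] F; first by rewrite average0.
by rewrite addSn !averageS; apply: eq_bigr => o _; rewrite IH.
Qed.

Lemma averageZ k a F : average k (fun xs => a * F xs) = a * average k F.
Proof. by rewrite /average mulr_sumr; apply: eq_bigr => xs _; rewrite mulrCA. Qed.

Lemma average_sum (I : Type) (s : seq I) k (F : I -> seq (option int) -> R) :
  average k (fun xs => \sum_(i <- s) F i xs) = \sum_(i <- s) average k (F i).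
Proof.
rewrite /average exchange_big; apply: eq_bigr => xs _.
by rewrite mulr_sumr.
Qed.

Lemma averageB k F G : average k (fun xs => F xs - G xs) = average k F - average k G.
Proof. by rewrite /average -sumrB; apply: eq_bigr => xs _; rewrite mulrBr. Qed.

Lemma average_swap j k (F : seq (option int) -> seq (option int) -> R) :
  average j (fun xs => average k (F xs)) =
  average k (fun ys => average j (fun xs => F xs ys)).
Proof.
rewrite {1}/average; under eq_bigr do rewrite -averageZ.
by rewrite -average_sum.
Qed.

Hypotheses (q_ge0 : 0 <= q) (tau_ge0 : 0 <= tau).

Lemma weight_ge0 o : 0 <= weight o.
Proof. by case: o => [x|] //=; rewrite mulr_ge0. Qed.

Lemma pattern_weight_ge0 xs : 0 <= pattern_weight xs.
Proof. by apply: prodr_ge0 => o _; exact: weight_ge0. Qed.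

Lemma ler_average k F G : (forall xs, xs \in patterns r k -> F xs <= G xs) ->
  average k F <= average k G.
Proof.
move=> FG; rewrite /average !big_seq; apply: ler_sum => xs hx.
by apply: ler_wpM2l; [exact: pattern_weight_ge0|exact: FG].
Qed.

Lemma average_ge0 k F : (forall xs, 0 <= F xs) -> 0 <= average k F.
Proof. by move=> F0; apply: sumr_ge0 => xs _; rewrite mulr_ge0// pattern_weight_ge0. Qed.

Local Notation L := (2 * r + 3)%:R.
Hypothesis q_le : q * (1 + tau * L) <= 1.

Lemma sum_weight : \sum_(o <- letters r) weight o = q * (1 + tau * L).
Proof.
rewrite /letters big_cons big_map /= big_const_seq count_predT size_window iter_addr_0.
rewrite -mulr_natr; ring.
Qed.

Lemma average1 k : average k (fun=> 1) = (q * (1 + tau * L)) ^+ k.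
Proof.
elim: k => [|k IH]; first by rewrite average0 expr0.
by rewrite averageS IH -mulr_suml sum_weight exprS.
Qed.

Lemma average1_le1 k : average k (fun=> 1) <= 1.
Proof.
rewrite average1 exprn_ile1// mulr_ge0// addr_ge0// mulr_ge0//.
Qed.

(** * Dominating dynamics *)

Variable mu : R.
Hypotheses (mu_ge0 : 0 <= mu) (mu_le : mu <= 2^-1).

Definition drive (o : option int) (f : int -> R) : int -> R := fun u =>
  if o is Some x then if `|u| < r%:Z then push mu x f u else f u else f u.

Definition drives xs f : int -> R := foldl (fun f o => drive o f) f xs.

Definition cap (f : int -> R) : int -> R := fun u => Num.min 1 (f u).

(* Dominates the distance of neighbours after the rings [xs], whatever the
   configuration before them; outside the radius r it keeps the trivial value 1,
   since edges out of the window may ring unobserved. *)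
Definition barrier xs : int -> R := foldl (fun f o => cap (drive o f)) (fun=> 1) xs.

Lemma drive_mono o f g : (forall u, f u <= g u) -> forall u, drive o f u <= drive o g u.
Proof.
move=> fg u; case: o => [x|] //=; case: ifP => // _.
by apply: push_mono.
Qed.

Lemma drives_mono xs f g : (forall u, f u <= g u) -> forall u, drives xs f u <= drives xs g u.
Proof.
by elim: xs f g => //= o xs IH f g fg; apply: IH; exact: drive_mono.
Qed.

Lemma drive_sum o (I : Type) (s : seq I) (a : I -> R) (F : I -> int -> R) u :
  drive o (fun w => \sum_(i <- s) a i * F i w) u =
  \sum_(i <- s) a i * drive o (F i) u.
Proof. by case: o => [x|] //=; case: ifP => // _; exact: push_sum. Qed.

Lemma drives_sum xs (I : Type) (s : seq I) (a : I -> R) (F : I -> int -> R) u :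
  drives xs (fun w => \sum_(i <- s) a i * F i w) u =
  \sum_(i <- s) a i * drives xs (F i) u.
Proof.
elim: xs F => //= o xs IH F; rewrite -IH; congr (drives xs _ u).
by apply/funext => w; exact: drive_sum.
Qed.

Lemma barrier_ge0 xs u : 0 <= barrier xs u.
Proof.
elim/last_ind: xs u => [|xs o IH] u; first exact: ler01.
rewrite /barrier -cats1 foldl_cat -/(barrier xs) /= /cap le_min ler01/=.
case: o => [x|] //=; case: ifP => // _.
exact: (push_ge0 mu_ge0 mu_le).
Qed.

Lemma barrier_le1 xs u : barrier xs u <= 1.
Proof.
elim/last_ind: xs u => [|xs o IH] u; first exact: lexx.
by rewrite /barrier -cats1 foldl_cat /= /cap ge_min lexx.
Qed.

Lemma barrier_outer xs u : r%:Z <= `|u| -> barrier xs u = 1.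
Proof.
move=> hu; elim/last_ind: xs => [//|xs o IH].
rewrite /barrier -cats1 foldl_cat -/(barrier xs) /= /cap.
by case: o => [x|] /=; rewrite ?ltNge ?hu/= IH minxx.
Qed.

(** Removing the caps along [ys] only raises the values, since [drive] is monotone; what remains is
    linear and commutes with averages. *)
Lemma barrier_cat xs ys u : barrier (xs ++ ys) u <= drives ys (barrier xs) u.
Proof.
elim/last_ind: ys u => [|ys o IH] u; first by rewrite cats0.
rewrite -rcons_cat /barrier -cats1 foldl_cat -/(barrier _) /=.
rewrite /drives -cats1 foldl_cat -/(drives _ _) /= /cap ge_min.
by apply/orP; right; exact: drive_mono.
Qed.

Lemma sum_window (f : int -> R) a : `|a| <= r.+1%:Z ->
  \sum_(x <- window r) f x * (x == a)%:R = f a.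
Proof.
move=> ha; rewrite (bigD1_seq a) ?mem_window ?uniq_window//=.
rewrite eqxx mulr1 big1 ?addr0// => x /negPf ->; exact: mulr0.
Qed.

(** Each of [u - 1], [u] and [u + 1] occurs exactly once in the window, so summing over the place of
    the ring produces a discrete Laplacian. *)
Lemma sum_push_window (f : int -> R) u : `|u| < r%:Z ->
  \sum_(x <- window r) push mu x f u =
  L * f u + mu * (f (u - 1) + f (u + 1) - 2 * f u).
Proof.
move=> hu.
have <- : \sum_(x <- window r) f u = L * f u.
  by rewrite big_const_seq count_predT size_window iter_addr_0 [RHS]mulr_natl.
rewrite -(@sum_window f (u - 1)); last by clear -hu; lia.
rewrite -(@sum_window f (u + 1)); last by clear -hu; lia.
rewrite -{2}(@sum_window f u); last by clear -hu; lia.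
rewrite mulr_sumr -big_split -sumrB mulr_sumr -big_split/=.
apply: eq_bigr => x _; rewrite /push.
have -> : (u == x + 1) = (x == u - 1) by clear; lia.
have -> : (u == x - 1) = (x == u + 1) by clear; lia.
by rewrite [u == x]eq_sym; ring.
Qed.

(** Inside the radius the Laplacian of the parabola adds q tau 2 mu b; outside, only the total
    weight of the letters enters, and it is at most 1. *)
Lemma drive_parabola (a b : R) u : 0 <= a -> 0 <= b ->
  \sum_(o <- letters r) weight o * drive o (parabola a b) u
  <= parabola (a + 2 * mu * b * tau) b u.
Proof.
move=> a0 b0.
have p0 w : 0 <= parabola a b w by rewrite addr_ge0// mulr_ge0// sqr_ge0.
have q1 : q <= 1.
  apply: le_trans q_le; rewrite ler_peMr// lerDl mulr_ge0//; exact: ler0n.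
have e0 : 0 <= 2 * mu * b * tau by rewrite !mulr_ge0.
rewrite big_cons big_map/= -mulr_sumr.
have -> : parabola (a + 2 * mu * b * tau) b u = parabola a b u + 2 * mu * b * tau.
  by rewrite /parabola; ring.
case: (boolP (`|u| < r%:Z)) => hu; last first.
  rewrite big_const_seq count_predT size_window iter_addr_0 -mulr_natr.
  apply: (@le_trans _ _ (q * (1 + tau * L) * parabola a b u)).
    by rewrite le_eqVlt; apply/orP; left; apply/eqP; ring.
  by apply: (le_trans (ler_wpM2r (p0 u) q_le)); rewrite !mul1r lerDl.
have -> : \sum_(x <- window r) push mu x (parabola a b) u =
    L * parabola a b u + 2 * mu * b.
  by rewrite sum_push_window// /parabola !intrD; ring.
apply: (@le_trans _ _ (q * (1 + tau * L) * parabola a b u + q * (2 * mu * b * tau))).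
  by rewrite le_eqVlt; apply/orP; left; apply/eqP; ring.
apply: lerD; first by rewrite -[leRHS]mul1r ler_wpM2r.
by rewrite -[leRHS]mul1r ler_wpM2r.
Qed.

(** The first letter acts first on the parabola, so by linearity it is averaged inside [drives],
    where it raises [a] by 2 mu b tau. *)
Lemma average_drives k (a b : R) u : 0 <= a -> 0 <= b ->
  average k (fun ys => drives ys (parabola a b) u)
  <= parabola (a + 2 * mu * b * tau * k%:R) b u.
Proof.
move=> a0 b0; elim: k a a0 => [|k IH] a a0.
  by rewrite average0 /= mulr0 addr0.
rewrite averageS.
under eq_bigr do rewrite -averageZ.
rewrite -average_sum.
have e0 : 0 <= 2 * mu * b * tau by rewrite !mulr_ge0.
apply: (@le_trans _ _ (average k (fun ys => drives ys (parabola (a + 2 * mu * b * tau) b) u))).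
  apply: ler_average => ys _ /=; rewrite -drives_sum.
  by apply: drives_mono => w; exact: drive_parabola.
apply: (le_trans (IH _ _)); first exact: addr_ge0.
by rewrite -natr1 /parabola; rewrite le_eqVlt; apply/orP; left; apply/eqP; ring.
Qed.

Lemma average_drives_barrier j ys u :
  average j (fun xs => drives ys (barrier xs) u) =
  drives ys (fun w => average j (fun xs => barrier xs w)) u.
Proof. by rewrite /average drives_sum. Qed.

(** The barrier after j steps can be replaced by its average, because the linear dynamics of the
    last k steps commutes with averaging over the first ones. *)
Lemma average_barrierD (j k : nat) (a b : R) u : 0 <= a -> 0 <= b ->
  (forall w, average j (fun xs => barrier xs w) <= parabola a b w) ->
  average (j + k) (fun xs => barrier xs u) <=
  parabola (a + 2 * mu * b * tau * k%:R) b u.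
Proof.
move=> a0 b0 IH; rewrite averageD.
apply: (le_trans _ (average_drives k u a0 b0)).
rewrite average_swap; apply: ler_average => ys _.
apply: (@le_trans _ _ (average j (fun xs => drives ys (barrier xs) u))).
  by apply: ler_average => xs _; exact: barrier_cat.
by rewrite average_drives_barrier; exact: drives_mono.
Qed.

(** * Patterns that contain a prescribed sequence of rings *)

Section special.
Variables (n : nat) (v : int).

(** The block contains v besides the sites v + 1, ..., v + n that push, since a ring at v would take
    mass from v. A ring out of the block can only add mass to it. *)
Definition inner (o : option int) := if o is Some x then v <= x <= v + n%:Z else false.

Lemma sum_weight_outer : q * (1 + tau * (L - n.+1%:R)) <=
  \sum_(o <- letters r | ~~ inner o) weight o.
Proof.
rewrite /letters big_cons big_map /= big_const_seq iter_addr_0.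
rewrite [leLHS](_ : _ = q + q * tau * (L - n.+1%:R)); last by ring.
rewrite lerD2l -[leRHS]mulr_natr; apply: ler_wpM2l; first exact: mulr_ge0.
rewrite lerBlDr -natrD ler_nat -(size_window r).
rewrite -(count_predC (fun x => inner (Some x)) (window r)) addnC leq_add2l.
rewrite -size_filter.
have -> : n.+1 = size [seq v + i%:Z | i <- iota 0 n.+1] by rewrite size_map size_iota.
apply: uniq_leq_size; first by rewrite filter_uniq// uniq_window.
move=> x; rewrite mem_filter => /andP[hx _]; apply/mapP.
exists (absz (x - v)); first by rewrite mem_iota; move: hx; rewrite /inner; clear; lia.
by move: hx; rewrite /inner; clear; lia.
Qed.

(** Only the order of the rings in the block is prescribed. Their times and all other rings are
    free, which keeps the probability bounded below when the window grows. *)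
Definition special (ms : seq int) (ys : seq (option int)) : bool :=
  [seq y <- ys | inner y] == map Some ms.

(** Binomial count of the steps at which the prescribed letters appear. The induction is Pascal's
    rule: the first letter is the next prescribed one, of weight q tau, or lies out of the block,
    with total weight at least z. *)
Lemma average_special (z : R) k ms : 0 <= z -> z <= q * (1 + tau * (L - n.+1%:R)) ->
  all (fun x => (`|x| <= r.+1%:Z) && inner (Some x)) ms ->
  'C(k, size ms)%:R * (q * tau) ^+ size ms * z ^+ (k - size ms) <=
  average k (fun ys => (special ms ys)%:R).
Proof.
move=> z0 zle; elim: k ms => [|k IH] ms hms.
  rewrite average0; case: ms {hms} => [|x ms]; rewrite /special ?eqxx/=.
    by rewrite bin0 !mul1r expr0.
  by rewrite bin0n/= !mul0r.
rewrite averageS (bigID inner)/=.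
have outer : z * average k (fun ys => (special ms ys)%:R) <=
  \sum_(o <- letters r | ~~ inner o)
     weight o * average k (fun xs => (special ms (o :: xs))%:R).
  rewrite (eq_bigr (fun o => weight o * average k (fun ys => (special ms ys)%:R))).
    rewrite -mulr_suml ler_wpM2r//; first by apply: average_ge0 => xs; exact: ler0n.
    exact: le_trans zle sum_weight_outer.
  move=> o /negPf ho; congr (_ * average _ _); apply/funext => xs.
  by rewrite /special /= ho.
case: ms hms outer => [|x ms] /= hms outer.
  apply: ler_wpDl.
    by apply: sumr_ge0 => o _; rewrite mulr_ge0 ?weight_ge0 ?average_ge0.
  apply: le_trans outer; rewrite bin0 subn0 !mul1r exprS ler_wpM2l//.
  by have := IH [::] isT; rewrite /= bin0 subn0 !mul1r.
case/andP: (hms) => /andP[xr xin] hms'.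
have inn : q * tau * average k (fun ys => (special ms ys)%:R) <=
  \sum_(o <- letters r | inner o)
     weight o * average k (fun xs => (special (x :: ms) (o :: xs))%:R).
  rewrite big_mkcond (bigD1_seq (Some x)) ?uniq_letters//=; last first.
    by rewrite inE/=; apply/mapP; exists x; rewrite ?mem_window.
  rewrite xin -[leLHS]addr0; apply: lerD; last first.
    apply: sumr_ge0 => o _; case: ifP => // _.
    by rewrite mulr_ge0 ?weight_ge0 ?average_ge0.
  apply: ler_wpM2l; first exact: mulr_ge0.
  apply: ler_average => ys _; rewrite /special /= xin.
  by rewrite eqseq_cons eqxx.
apply: le_trans (lerD inn outer).
rewrite binS addnC natrD !mulrDl; apply: lerD.
  rewrite subSS exprS; apply: le_trans (ler_wpM2l _ (IH ms hms')); last exact: mulr_ge0.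
  by rewrite le_eqVlt; apply/orP; left; apply/eqP; ring.
apply: le_trans (ler_wpM2l z0 (IH (x :: ms) hms)).
have [h|h] := ltnP k (size ms).+1.
  by rewrite /= bin_small// !mul0r mulr0.
rewrite /= subSS -(subnSK h) [z ^+ _.+1]exprS.
by rewrite le_eqVlt; apply/orP; left; apply/eqP; ring.
Qed.

Lemma drives_special ms ys (f g : int -> R) : `|v| + n%:Z < r%:Z ->
  all (fun x => v + 1 <= x <= v + n%:Z) ms -> special ms ys ->
  (forall u, 0 <= f u) ->
  (forall u, v <= u <= v + n%:Z -> g u <= f u) ->
  forall u, v <= u <= v + n%:Z -> pushes mu ms g u <= drives ys f u.
Proof.
move=> hv; elim: ys ms f g => [|o ys IH] ms f g hms.
  by rewrite /special /= => /eqP; case: ms hms.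
rewrite /special /=; case: ifP => [|ho].
  case: o => // x; case: ms hms => // x' ms /= /andP[hx hms] xin.
  rewrite eqseq_cons => /andP[/eqP[ex] hs] f0 gf; subst x'.
  apply: IH => //.
    by move=> u; rewrite /drive; case: (boolP (`|u| < r%:Z)) => _ //; exact: (push_ge0 mu_ge0 mu_le).
  move=> u hu; rewrite /drive (_ : `|u| < r%:Z); last by move: hv hu; clear; lia.
  by apply: push_mono => //; apply: gf.
move=> hs f0 gf; apply: IH => //.
  by move=> u; case: o ho => //= x _; case: (boolP (`|u| < r%:Z)) => _ //; exact: (push_ge0 mu_ge0 mu_le).
move=> u hu; apply: (le_trans (gf u hu)).
case: o ho => // x /= xout; case: ifP => // _.
have nx : u != x by apply/eqP => e; move: xout hu; rewrite e => ->.
have [e|n1] := eqVneq u (x + 1); first by rewrite e push_right lerDl mulr_ge0.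
have [e|n2] := eqVneq u (x - 1); first by rewrite e push_left lerDl mulr_ge0.
by rewrite push_far.
Qed.

End special.

(** On a special pattern the linear bound at u reaches a W while the barrier is capped at 1, so the
    excess a W - 1 can be subtracted with probability at least p. *)
Lemma average_barrierD_special (j k n : nat) (a b p W : R) (s : seq int) (u : int) :
  0 <= a -> 0 <= b -> 0 <= p -> 1 <= a * W -> `|u| + n%:Z < r%:Z ->
  all (fun x => 1 <= x <= n%:Z) s -> W <= pushes mu s (fun=> 1) 0 ->
  p <= average k (fun ys => (special n u [seq u + x | x <- s] ys)%:R) ->
  (forall w, average j (fun xs => barrier xs w) <= parabola a b w) ->
  average (j + k) (fun xs => barrier xs u) <=
  parabola (a + 2 * mu * b * tau * k%:R + p * (1 - a * W)) b u.
Proof.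
move=> a0 b0 p0 aW hu hs hW hp IH; rewrite averageD average_swap.
pose S ys := special n u [seq u + x | x <- s] ys.
have par0 w : 0 <= parabola a b w by rewrite addr_ge0// mulr_ge0// sqr_ge0.
apply: (@le_trans _ _ (average k (fun ys => drives ys (parabola a b) u -
    (a * W - 1) * (S ys)%:R))); last first.
  rewrite averageB averageZ.
  apply: (@le_trans _ _ (parabola (a + 2 * mu * b * tau * k%:R) b u - (a * W - 1) * p)).
    apply: lerB; first exact: average_drives.
    by apply: ler_wpM2l => //; rewrite subr_ge0.
  by rewrite /parabola; rewrite le_eqVlt; apply/orP; left; apply/eqP; ring.
apply: ler_average => ys _.
have [Sy|_] := boolP (S ys); last first.
  rewrite mulr0 subr0.
  apply: (@le_trans _ _ (average j (fun xs => drives ys (barrier xs) u))).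
    by apply: ler_average => xs _; exact: barrier_cat.
  by rewrite average_drives_barrier; exact: drives_mono.
apply: (@le_trans _ _ 1).
  apply: (le_trans _ (average1_le1 j)).
  by apply: ler_average => xs _; exact: barrier_le1.
have h : a * W <= drives ys (parabola a b) u.
  have hs' : all (fun x => u + 1 <= x <= u + n%:Z) [seq u + x | x <- s].
    by apply/allP => _ /mapP[x /(allP hs) hx ->]; rewrite !lerD2l.
  have hg w : u <= w <= u + n%:Z -> a <= parabola a b w.
    by move=> _; rewrite /parabola lerDl mulr_ge0// sqr_ge0.
  apply: le_trans (drives_special hu hs' Sy par0 hg _); last by rewrite lexx lerDl.
  have -> : pushes mu [seq u + x | x <- s] (fun=> a) u = a * pushes mu s (fun=> 1) 0.
    rewrite -[X in pushes _ _ _ X](addr0 u) pushes_shift.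
    elim/last_ind: s {hs hW hp S Sy hs' hg} (0 : int) => [w|s x IHs w].
      by rewrite /pushes/= mulr1.
    by rewrite !pushes_rcons /push !IHs; ring.
  exact: ler_wpM2l.
by rewrite mulr1; lra.
Qed.

End average.

(** For 0 <= x <= 1/2 one has 1 / (1 - x) <= 1 + 2 x <= exp (2 x); this is taken with x = c / k and
    raised to the power k >= i. *)
Lemma expR_le_exprn (R : realType) (c : R) (k i : nat) :
  0 <= c -> 2 * c <= k%:R -> (0 < k)%N -> (i <= k)%N ->
  expR (- (2 * c)) <= (1 - k%:R^-1 * c) ^+ i.
Proof.
move=> c0 ck k0 ik.
have kR : 0 < k%:R :> R by rewrite ltr0n.
set x := k%:R^-1 * c.
have x0 : 0 <= x by rewrite mulr_ge0// invr_ge0 ltW.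
have x1 : 2 * x <= 1 by rewrite /x mulrCA mulrC ler_pdivrMr ?mul1r.
apply: (@le_trans _ _ ((1 - x) ^+ k)); last first.
  by rewrite -(subnK ik) exprD ler_piMl ?exprn_ge0 ?exprn_ile1//; lra.
have -> : - (2 * c) = - (2 * x) * k%:R.
  by rewrite /x; field; rewrite gt_eqF.
rewrite expRM_natr lerXn2r ?nnegrE ?expR_ge0//; first by lra.
rewrite expRN -[leRHS]invrK lef_pV2 ?posrE ?expR_gt0 ?invr_gt0//; last by lra.
apply: (le_trans _ (expR_ge1Dx (2 * x))).
rewrite -[leLHS]div1r ler_pdivrMr; last by lra.
have : 0 <= x * (1 - 2 * x) by rewrite mulr_ge0// subr_ge0.
by lra.
Qed.

(** Each of the i factors k - j of the falling factorial is at least k / 2. *)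
Lemma bin_ge (R : realType) (k i : nat) : (2 * i <= k)%N ->
  (k%:R / 2) ^+ i / i`!%:R <= 'C(k, i)%:R :> R.
Proof.
move=> ik; rewrite ler_pdivrMr ?ltr0n ?fact_gt0// -natrM bin_ffact ffact_prod.
rewrite natr_prod -[X in _ ^+ X](card_ord i) -prodr_const.
apply: ler_prod => j _; rewrite divr_ge0//= natrB; last by have := ltn_ord j; lia.
have : j%:R <= k%:R / 2 :> R.
  rewrite ler_pdivlMr// -natrM ler_nat; have := ltn_ord j; lia.
by lra.
Qed.

(** * Decay of the averaged barrier *)

Section decay.
Context (R : realType) (mu : R) (mu_gt0 : 0 < mu) (mu_le : mu <= 2^-1).

(* [q] stands for [expR (- L / k)], the probability that no edge of the window
   rings during a time step [k^-1]. *)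
Definition step_probability (r k : nat) (q : R) :=
  [/\ 0 <= q, 1 - k%:R^-1 * (2 * r + 3)%:R <= q &
      q * (1 + k%:R^-1 * (2 * r + 3)%:R) <= 1].

(** For fine steps the binomial bound is close to a Poisson one, so p can depend on n and m only,
    and not on the radius, the place of the block or k. *)
Lemma average_special_ge (n m : nat) : exists2 p : R, 0 < p &
  forall r : nat, (n <= r)%N -> exists k0 : nat, forall k, (k0 <= k)%N ->
  forall q v ms, step_probability r k q ->
  all (fun x => (`|x| <= r.+1%:Z) && inner n v (Some x)) ms -> size ms = m ->
  p <= average r q k%:R^-1 k (fun ys => (special n v ms ys)%:R).
Proof.
(* One factor 1/2 comes from [bin_ge] and one from q >= 1/2, hence 4 ^ m; the exponential bounds the
   power of z. *)
exists ((4 ^+ m * m`!%:R)^-1 * expR (- (2 * n.+2%:R))).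
  by rewrite mulr_gt0 ?expR_gt0// invr_gt0 mulr_gt0 ?exprn_gt0// ltr0n fact_gt0.
move=> r nr; pose L := (2 * r + 3)%N.
exists (maxn (L * L) (maxn (2 * m) (2 * n.+2))) => k.
rewrite !geq_max => /andP[kL /andP[km kn]] q v ms [q0 qge qle] hms sm; subst m.
have L1n : (0 < L)%N by rewrite /L addnS.
have Lnn : (n.+1 <= L)%N by rewrite /L addn3 !ltnS; clear -nr; lia.
have kLn : (2 * L <= k)%N.
  by apply: leq_trans kL; rewrite leq_mul2r /L addn3 orbT.
have k0 : (0 < k)%N by apply: leq_trans kn; rewrite mulnS.
have kR : 0 < k%:R :> R by rewrite ltr0n.
set t : R := k%:R^-1 in qge qle *.
have t0 : 0 < t by rewrite invr_gt0.
have kt : k%:R * t = 1 by rewrite divff// gt_eqF.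
have tL : t * L%:R ^+ 2 <= 1.
  by rewrite mulrC ler_pdivrMr// mul1r -natrX ler_nat expnS expn1.
have L1 : 1 <= L%:R :> R by rewrite ler1n.
have q2 : 2^-1 <= q.
  apply: le_trans qge; rewrite -/L.
  have : 2 * L%:R <= k%:R :> R by rewrite -natrM ler_nat.
  move=> h; have : t * L%:R <= 2^-1.
    by rewrite mulrC ler_pdivrMr//; lra.
  by lra.
(* To first order in t the right side of [zle] is 1 - t (n + 1); one more t absorbs the second
   order, since t L ^ 2 <= 1. *)
pose z : R := 1 - t * n.+2%:R.
have tn : t * n.+2%:R <= 2^-1.
  rewrite mulrC ler_pdivrMr//.
  have : 2 * n.+2%:R <= k%:R :> R by rewrite -natrM ler_nat.
  by lra.
have z0 : 0 <= z by rewrite /z; lra.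
have zle : z <= q * (1 + t * (L%:R - n.+1%:R)).
  have Ln : n.+1%:R <= L%:R :> R by rewrite ler_nat.
  apply: (@le_trans _ _ ((1 - t * L%:R) * (1 + t * (L%:R - n.+1%:R)))); last first.
    apply: ler_wpM2r => //; rewrite addr_ge0// mulr_ge0 ?subr_ge0//; exact: ltW.
  have h1 : 0 <= t * t * L%:R * n.+1%:R by rewrite !mulr_ge0// ltW.
  have h2 : t * (t * L%:R ^+ 2) <= t by rewrite ler_piMr// ltW.
  rewrite /z -[n.+2]addn1 natrD.
  by lra.
have := average_special q0 (ltW t0) k z0 zle hms.
apply: le_trans; apply: ler_pM.
- by rewrite invr_ge0 mulr_ge0 ?exprn_ge0.
- exact: expR_ge0.
- apply: (@le_trans _ _ ((k%:R / 2) ^+ size ms / (size ms)`!%:R * (q * t) ^+ size ms)).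
    rewrite mulrAC -exprMn invfM -exprVn.
    apply: ler_wpM2r; first by rewrite invr_ge0 ler0n.
    apply: lerXn2r; rewrite ?nnegrE ?invr_ge0 ?ler0n//.
      by rewrite mulr_ge0// ?mulr_ge0// ltW.
    rewrite [leRHS](_ : _ = k%:R * t * q / 2); last by ring.
    by rewrite kt; lra.
  by apply: ler_wpM2r; [rewrite exprn_ge0// mulr_ge0// ltW|exact: bin_ge].
- apply: expR_le_exprn => //; last exact: leq_subr.
  by rewrite -natrM ler_nat.
Qed.

(** In each unit of time the level of the parabola drops by p as long as it is above 2 / W, up to a
    drift e due to the curvature. *)
Lemma average_barrier_le (v : int) (eps : R) : 0 < eps ->
  exists T r k0 : nat, forall k, (k0 <= k)%N -> forall q, step_probability r k q ->
  average r q k%:R^-1 (T * k) (fun xs => barrier r mu xs v) <= eps.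
Proof.
move=> eps0.
pose n := (Num.truncn (8 / eps)).+1.
pose W : R := n%:R / 2.
have W0 : 0 < W by rewrite divr_gt0// ltr0n.
have Weps : 2 / W <= eps / 2.
  have : 8 / eps < n%:R by exact: truncnS_gt.
  rewrite ltr_pdivrMr// => h.
  by rewrite ler_pdivrMr// /W; lra.
have [s sn sW] := pushes_concentrate mu_gt0 mu_le n.
have [p p0 hp] := average_special_ge n (size s).
(* The number of time units is fixed by p alone, before the radius r, so b can be taken small in
   terms of T. *)
pose T := (Num.truncn p^-1).+1.
have Tp : 1 <= T%:R * p.
  by rewrite -ler_pdivrMr// mul1r ltW//; exact: truncnS_gt.
(* C b is the total error of the parabola: its excess b v ^ 2 at v plus the drift 2 mu b during T
   units of time. *)
pose C : R := v%:~R ^+ 2 + 2 * mu * T%:R.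
have C0 : 0 <= C by rewrite addr_ge0 ?sqr_ge0// !mulr_ge0// ?ler0n ?ltW.
pose D := (Num.truncn (2 * C / eps)).+1.
(* The margin n lets the block of every site u with |u| < D fit within the radius. *)
pose r := (n + D)%N.
have D1 : 1 <= D%:R :> R by rewrite ler1n.
have D0 : 0 < D%:R :> R by rewrite ltr0n.
pose b : R := (D%:R ^+ 2)^-1.
have b0 : 0 <= b by rewrite invr_ge0 sqr_ge0.
have Cb : C * b <= eps / 2.
  rewrite ler_pdivrMr ?exprn_gt0//.
  have : 2 * C / eps < D%:R by exact: truncnS_gt.
  rewrite ltr_pdivrMr// => h.
  have : D%:R <= D%:R ^+ 2 :> R by rewrite expr2 ler_peMl// ltW.
  have e2 : 0 < eps / 2 by rewrite divr_gt0.
  by rewrite -(ler_pM2l e2) => h2; lra.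
have [k0 hk0] := hp r (leq_addr _ _).
exists T, r, (maxn 1 k0) => k; rewrite geq_max => /andP[k1 kk0] q hq.
have kR : 0 < k%:R :> R by rewrite ltr0n.
case: (hq) => q0 _ qle.
pose t : R := k%:R^-1.
have t0 : 0 <= t by rewrite invr_ge0 ltW.
have tk : t * k%:R = 1 by rewrite mulVf// gt_eqF.
pose e := 2 * mu * b.
have e0 : 0 <= e by rewrite /e !mulr_ge0// ltW.
pose a i : R := Num.max (2 / W) (1 - i%:R * p) + i%:R * e.
have a0 i : 0 <= a i.
  apply: addr_ge0; last by rewrite mulr_ge0.
  by rewrite le_max divr_ge0// ltW.
suff H i u : average r q t (i * k) (fun xs => barrier r mu xs u) <= parabola (a i) b u.
  apply: (le_trans (H T v)); rewrite /parabola.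
  rewrite /a max_l; last first.
    by apply: (@le_trans _ _ 0); [rewrite subr_le0|rewrite divr_ge0// ltW].
  have -> : 2 / W + T%:R * e + b * v%:~R ^+ 2 = 2 / W + C * b by rewrite /e /C; ring.
  by lra.
have mu0 := ltW mu_gt0.
elim: i u => [|i IH] u.
  rewrite mul0n average0 /barrier /= /parabola.
  rewrite /a mul0r subr0 mul0r addr0.
  apply: (@le_trans _ _ (Num.max (2 / W) 1)); first by rewrite le_max lexx orbT.
  by rewrite lerDl mulr_ge0 ?sqr_ge0.
rewrite mulSn addnC.
(* Once 1 - i p is below the floor 2 / W, only the drift has to be accounted for. *)
have [ai|ai] := leP (1 - i%:R * p) (2 / W).
  apply: (le_trans (average_barrierD q0 t0 qle mu0 mu_le k u (a0 i) b0 IH)).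
  rewrite /parabola -[_ * t * k%:R]mulrA tk mulr1 lerD2r -/e /a max_l// max_l.
    by rewrite -natr1; lra.
  by apply: le_trans ai; rewrite -natr1; lra.
(* At the sites without room for the block one has |u| >= D, and the parabola is already at least
   1. *)
have [hu|hu] := ltP (`|u| + n%:Z) r%:Z; last first.
  apply: (@le_trans _ _ 1).
    apply: (le_trans _ (average1_le1 q0 t0 qle (i * k + k))).
    by apply: ler_average => // xs _; exact: barrier_le1.
  rewrite /parabola -[leLHS]add0r lerD// /b mulrC ler_pdivlMr ?mul1r ?exprn_gt0//.
  have : D%:Z <= `|u| by rewrite -(lerD2r n%:Z) (le_trans _ hu)// /r PoszD addrC.
  rewrite -(ler_int R) intr_norm => h.
  by rewrite -[u%:~R ^+ 2]real_normK ?num_real// lerXn2r ?nnegrE.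
have ale : 1 - i%:R * p <= a i.
  by rewrite /a max_r; [rewrite lerDl mulr_ge0|exact: ltW].
(* With a W >= 2 the gain p (a W - 1) is at least p. *)
have aW : 2 <= a i * W.
  by rewrite -ler_pdivrMr//; apply: le_trans ale; exact: ltW.
have hs : p <= average r q t k (fun ys => (special n u [seq u + x | x <- s] ys)%:R).
  apply: hk0 => //; last by rewrite size_map.
  apply/allP => _ /mapP[x /(allP sn) hx ->]; rewrite /inner.
  by move: hu hx; move: (r) => r' hu hx; apply/andP; split; clear -hu hx; lia.
have aW1 : 1 <= a i * W by apply: le_trans aW; lra.
apply: (le_trans (average_barrierD_special q0 t0 qle mu0 mu_le (a0 i) b0 (ltW p0) aW1 hu sn sW hs IH)).
rewrite /parabola -[_ * t * k%:R]mulrA tk mulr1 lerD2r -/e.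
have -> : a i.+1 = Num.max (2 / W) (1 - i.+1%:R * p) + i.+1%:R * e by [].
have : 1 - i.+1%:R * p <= Num.max (2 / W) (1 - i.+1%:R * p) by rewrite le_max lexx orbT.
have h : p * (1 - a i * W) <= - p.
  by rewrite -[leRHS]mulrN1; apply: ler_wpM2l; [exact: ltW|lra].
have ei : a i = 1 - i%:R * p + i%:R * e by rewrite /a max_r// ltW.
move: (p * (1 - a i * W)) h => z h; rewrite ei -natr1; lra.
Qed.

End decay.

(** * The circle *)

Section circle.
Context (R : realType).
Implicit Types (x y : R) (z u v : circle R).

Lemma circle_repDz x (k : int) : circle_rep (x + 2 * k%:~R) = circle_rep x.
Proof.
rewrite /circle_rep (_ : (x + 2 * k%:~R - 1) / 2 = (x - 1) / 2 + k%:~R); last by field.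
by rewrite ceilDrz ?intr_int// intrKceil intrD; ring.
Qed.

Lemma circle_rep_id x : -1 < x <= 1 -> circle_rep x = x.
Proof.
move=> /andP[x1 x2]; rewrite /circle_rep (_ : Num.ceil _ = 0) ?mulr0 ?subr0//.
by apply: ceil_def; rewrite sub0r rmorphN /=; apply/andP; split; lra.
Qed.

Lemma circle_repE x : exists k : int, circle_rep x = x + 2 * k%:~R.
Proof.
by exists (- Num.ceil ((x - 1) / 2)); rewrite /circle_rep rmorphN /= mulrN.
Qed.

Lemma circle_ofDz x (k : int) : circle_of (x + 2 * k%:~R) = circle_of x.
Proof. by apply: val_inj => /=; exact: circle_repDz. Qed.

Lemma circle_valK z : circle_of (circle_val z) = z.
Proof. by apply: val_inj => /=; apply: circle_rep_id; case: z. Qed.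

Lemma circle_of_repD x y : circle_of (circle_rep x + y) = circle_of (x + y).
Proof. by have [k ->] := circle_repE x; rewrite addrAC circle_ofDz. Qed.

Lemma circle_dist_le1 u v : circle_dist u v <= 1.
Proof. by rewrite /circle_dist ge_min; case: (leP `|circle_val u - circle_val v| 1) => //= h; lra. Qed.

Lemma circle_dist_ge0 u v : 0 <= circle_dist u v.
Proof.
rewrite /circle_dist le_min normr_ge0/= subr_ge0.
case: u v => [x /andP[x1 x2]] [y /andP[y1 y2]] /=.
by rewrite ler_norml; apply/andP; split; lra.
Qed.

Lemma normr_step b u v : `|step b u v| = circle_dist u v.
Proof.
have -> : `|step b u v| = `|circle_rep (circle_val v - circle_val u)|.
  rewrite /step; case: eqP => [->|//].
  by case: b; rewrite ?normrN normr1.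
rewrite /circle_dist minEle.
case: u v => [x /andP[x1 x2]] [y /andP[y1 y2]] /=.
have [h1|h1] := leP (y - x) (-1).
  rewrite -(circle_repDz _ 1) circle_rep_id; last by apply/andP; split; lra.
  by case: (ger0P (x - y)) => h2; case: (ger0P (y - x + 2 * 1%:~R)) => h3;
    case: ifP => h4; lra.
have [h2|h2] := leP (y - x) 1.
  rewrite circle_rep_id; last by apply/andP; split; lra.
  by rewrite distrC; case: ifP => //; case: (ger0P (x - y)) => h3 h4; lra.
rewrite -(circle_repDz _ (-1)) circle_rep_id; last by apply/andP; split; lra.
by case: (ger0P (x - y)) => h3; case: (ger0P (y - x + 2 * (-1)%:~R)) => h4;
  case: ifP => h5; lra.
Qed.

(** The tie is harmless: 1 and -1 agree modulo 2, so the displacement leads from u to v for either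
    coin. *)
Lemma circle_of_step b u v : circle_of (circle_val u + step b u v) = v.
Proof.
have rep : circle_of (circle_val u + circle_rep (circle_val v - circle_val u)) = v.
  by rewrite addrC circle_of_repD subrK circle_valK.
rewrite /step; case: eqP => // e; rewrite -[RHS]rep e; case: b => //.
by rewrite -(circle_ofDz _ 1); congr circle_of; lra.
Qed.

Lemma circle_dist_move z (d : R) : circle_dist z (circle_of (circle_val z + d)) <= `|d|.
Proof.
rewrite -[z in circle_dist z]circle_valK; apply: le_trans (circle_dist_of _ _) _.
by rewrite opprD addNKr normrN.
Qed.

(** On lifts, u moves to u + mu sigma and v to u + sigma - mu sigma, which differ by (1 - 2 mu)
    sigma; [mu <= 2^-1] fixes the sign. *)
Lemma circle_dist_ring (mu : R) b u v : mu <= 2^-1 ->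
  circle_dist (circle_of (circle_val u + mu * step b u v))
    (circle_of (circle_val v - mu * step b u v)) <= (1 - 2 * mu) * circle_dist u v.
Proof.
move=> mule; set s := step b u v.
have -> : circle_of (circle_val v - mu * s) = circle_of (circle_val u + s - mu * s).
  rewrite -[in LHS](circle_of_step b u v) -/s /=; exact: circle_of_repD.
apply: (le_trans (circle_dist_of _ _)).
rewrite -(normr_step b) -/s (_ : _ - _ = - ((1 - 2 * mu) * s)); last by ring.
by rewrite normrN normrM ger0_norm//; lra.
Qed.

End circle.

(** * Paths of the model *)

Definition update (R : realType) (mu : R) (bit : int -> bool) (o : option int) (z : config R) : config R :=
  if o is Some x then
    let sigma := step (bit x) (z x) (z (x + 1)) in
    fun v => if v == x then circle_of (circle_val (z x) + mu * sigma)
      else if v == x + 1 then circle_of (circle_val (z (x + 1)) - mu * sigma)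
      else z v
  else z.

(** The prefix [take i xs] includes the current letter, so the k-th ring of an edge uses its coin of
    index k >= 1, as in [compass_path]. *)
Fixpoint evolve (R : realType) (mu : R) (b : int -> nat -> bool)
    (xs : seq (option int)) (i : nat) (z : config R) : config R :=
  if i is i'.+1 then
    update mu (fun x => b x (count_mem (Some x) (take i xs))) (nth None xs i')
      (evolve mu b xs i' z)
  else z.

Section clock.
Context (R : realType).

Definition clock_path (m : R -> nat) :=
  (forall s t, 0 <= s -> s <= t -> (m s <= m t)%N) /\
  (forall t, 0 <= t -> m s @[s --> t^'+] --> m t).

(** The jump is at the supremum t of the times up to s' at which [m] still equals [m s]. If [m t]
    were [m s], right continuity would extend this value beyond t. *)
Lemma jump_time (m : R -> nat) s s' : clock_path m -> 0 <= s -> s <= s' ->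
  m s' = (m s).+1 -> exists t, [/\ s < t, t <= s',
    forall r, s <= r -> r < t -> m r = m s, jumps_at m t & m t = m s'].
Proof.
move=> [mono rc] s0 ss' ms'.
pose A := [set r | [/\ s <= r, r <= s' & m r = m s]].
have As : A s by split.
have supA : has_sup A by split; [exists s|exists s' => r []].
pose t := sup A.
have st : s <= t by apply: sup_upper_bound.
have ts' : t <= s' by apply: ge_sup; [exists s|move=> r []].
have before r : s <= r -> r < t -> m r = m s.
  move=> sr rt; apply/eqP; rewrite eqn_leq (mono s r)// andbT.
  have [|a [sa as' ma]] := @sup_adherent _ A (t - r) _ supA; first by rewrite subr_gt0.
  by rewrite -/t subKr => ra; rewrite -ma; apply: mono; [exact: le_trans sr|exact: ltW].
have t0 : 0 <= t := le_trans s0 st.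
have mt : m t = m s'.
  apply/eqP; rewrite eqn_leq (mono t s')//= ms' ltn_neqAle (mono s t)// andbT.
  apply/eqP => mst.
  have ltts' : t < s'.
    by rewrite lt_neqAle ts' andbT; apply/eqP => e; move: ms'; rewrite -e -mst; lia.
  have /(_ [set m t]) := rc t t0; rewrite nbhs_principalE => /(_ (iffRL (principal_filterP _ _) erefl)) near_t'.
  have near_t : \forall r \near t^'+, m r = m t by exact: near_t'.
  have near_s' : \forall r \near t^'+, r < s' by exact: nbhs_right_lt.
  have near_gt : \forall r \near t^'+, t < r by exact: nbhs_right_gt.
  have [r [[mr rs'] tr]] : exists r, (m r = m t /\ r < s') /\ t < r.
    by apply: (@filter_ex _ (t^'+)); do 2 apply: filterI => //.
  have : r <= t.
    by apply: sup_upper_bound => //; split; [exact/ltW/(le_lt_trans st)|exact: ltW|rewrite mr -mst].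
  by rewrite leNgt tr.
have ltst : s < t.
  by rewrite lt_neqAle st andbT; apply/eqP => e; move: ms'; rewrite -mt -e; lia.
exists t; split => //; split; first exact: le_lt_trans ltst.
move=> r r0 rt; rewrite mt ms' ltnS.
have [sr|rs] := leP s r; first by rewrite before.
exact: mono (ltW rs).
Qed.

Lemma clock_path_const (m : R -> nat) s t r : clock_path m -> 0 <= s -> m s = m t ->
  s <= r -> r <= t -> m r = m s /\ m r = m t.
Proof.
move=> [mono _] s0 mst sr rt; suff : m r = m s by rewrite -mst.
apply/eqP; rewrite eqn_leq (mono s r)// andbT mst; apply: mono => //; exact: le_trans sr.
Qed.

End clock.

Section path.
Context (R : realType) (mu : R) (n : int -> R -> nat) (b : int -> nat -> bool).
Context (eta : R -> int -> circle R).
Hypothesis n_clock : forall v, clock_path (n v).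
Hypothesis eta_path : compass_path mu n b eta.

(** Apart from the single jump of x, the edges x - 1, x and x + 1 are silent between s and s'. Hence
    the left limits at the jump are the opinions at time s, and the new opinions last until s'. *)
Lemma eta_ring x s s' : 0 <= s -> s <= s' ->
  n (x - 1) s = n (x - 1) s' -> n (x + 1) s = n (x + 1) s' ->
  n x s' = (n x s).+1 ->
  let sigma := step (b x (n x s')) (eta s x) (eta s (x + 1)) in
  eta s' x = circle_of (circle_val (eta s x) + mu * sigma) /\
  eta s' (x + 1) = circle_of (circle_val (eta s (x + 1)) - mu * sigma).
Proof.
move=> s0 ss' ql qr ring sigma.
have [t [st ts' before jump nt]] := jump_time (n_clock x) s0 ss' ring.
have const v r r' : s <= r -> r <= r' -> r' <= s' ->
    n (v - 1) r = n (v - 1) r' -> n v r = n v r' -> eta r' v = eta r v.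
  by move=> sr rr' rs'; apply: (compass_const eta_path) => //; exact: le_trans sr.
have left_lim v : (forall r, s <= r -> r < t -> n (v - 1) s = n (v - 1) r /\ n v s = n v r) ->
    lim (eta r v @[r --> t^'-]) = eta s v.
  move=> h; apply: lim_near_cst; first exact: metric_hausdorff.
  near=> r.
  have sr : s < r by near: r; exact: nbhs_left_gt.
  have rt : r < t by near: r; exact: nbhs_left_lt.
  have [h1 h2] := h r (ltW sr) rt.
  by apply: const => //; [exact: ltW|exact/ltW/(lt_le_trans rt)].
have quiet v r : n v s = n v s' -> s <= r -> r < t -> n v s = n v r.
  move=> q sr rt.
  by case: (clock_path_const (n_clock v) s0 q sr (ltW (lt_le_trans rt ts'))) => ->.
have quiet2 v : n v s = n v s' -> n v t = n v s'.
  by move=> q; case: (clock_path_const (n_clock v) s0 q (ltW st) ts').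
have := compass_jump eta_path jump.
rewrite !left_lim; first last.
- by move=> r sr rt; split; [exact: quiet|rewrite before].
- by move=> r sr rt; rewrite addrK; split; [rewrite before|exact: quiet].
rewrite nt -/sigma => -[<- <-]; split.
  by apply: const => //; [exact: ltW|exact: quiet2].
by apply: const => //; rewrite ?addrK//; [exact: ltW|exact: quiet2].
Unshelve. all: by end_near. Qed.

Definition spread s (u : int) : R := circle_dist (eta s u) (eta s (u + 1)).

Definition fits r (o : option int) s s' :=
  forall u, u \in window r -> n u s' = (n u s + (o == Some u))%N.

Hypotheses (mu_ge0 : 0 <= mu) (mu_le : mu <= 2^-1).

Lemma fits_quiet r o s s' u : fits r o s s' -> `|u| <= r.+1%:Z -> o <> Some u ->
  n u s = n u s'.
Proof.
by rewrite -mem_window => f /f -> /eqP/negPf ->; rewrite addn0.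
Qed.

Lemma eta_quiet r o s s' u : 0 <= s -> s <= s' -> fits r o s s' -> `|u| <= r.+1%:Z ->
  `|u - 1| <= r.+1%:Z -> o <> Some u -> o <> Some (u - 1) -> eta s' u = eta s u.
Proof.
move=> s0 ss' f hu hu1 ou ou1.
by apply: (compass_const eta_path) => //; apply: fits_quiet f _ _.
Qed.

(** The distance across the ringing edge contracts. Next to that edge, the common endpoint moves by
    at most mu times this distance and the triangle inequality applies. Farther away nothing
    moves. *)
Lemma spread_drive r o s s' u : 0 <= s -> s <= s' -> fits r o s s' ->
  `|u| < r%:Z -> spread s' u <= drive r mu o (spread s) u.
Proof.
move=> s0 ss' f hu.
have w0 : `|u| <= r.+1%:Z by clear -hu; lia.
have w1 : `|u - 1| <= r.+1%:Z by clear -hu; lia.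
have w2 : `|u + 1| <= r.+1%:Z by clear -hu; lia.
case: o f => [x|] f /=; last first.
  by rewrite /spread !(eta_quiet s0 ss' f)// addrK.
rewrite hu.
have ring y : y = x -> `|y| <= r.+1%:Z -> `|y - 1| <= r.+1%:Z -> `|y + 1| <= r.+1%:Z ->
  let sigma := step (b y (n y s')) (eta s y) (eta s (y + 1)) in
  eta s' y = circle_of (circle_val (eta s y) + mu * sigma) /\
  eta s' (y + 1) = circle_of (circle_val (eta s (y + 1)) - mu * sigma).
  move=> yx hy hy1 hy2; subst y; apply: eta_ring => //.
  - by apply: fits_quiet f _ _ => //; case; clear; lia.
  - by apply: fits_quiet f _ _ => //; case; clear; lia.
  - by rewrite f ?mem_window// eqxx addn1.
have [ux|nx] := eqVneq u x.
  have [e1 e2] := ring u ux w0 w1 w2.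
  by rewrite -ux push_id /spread e1 e2; exact: circle_dist_ring.
have [ux|n1] := eqVneq u (x + 1).
  have ux' : u - 1 = x by rewrite ux addrK.
  have w3 : `|u - 1 - 1| <= r.+1%:Z by clear -hu; lia.
  have w4 : `|u - 1 + 1| <= r.+1%:Z by clear -hu; lia.
  have [_ e] := ring (u - 1) ux' w1 w3 w4.
  rewrite ux push_right -ux -ux' /spread.
  rewrite subrK in e *.
  rewrite e (eta_quiet s0 ss' f w2); first last.
  - by rewrite addrK; case => xu; move: nx; rewrite xu eqxx.
  - by rewrite ux; case; clear; lia.
  - by rewrite addrK.
  rewrite [leRHS]addrC; apply: (le_trans (circle_dist_triangle (eta s u) _ _)).
  rewrite lerD2r circle_distC; apply: (le_trans (circle_dist_move _ _)).
  by rewrite normrN normrM normr_step ger0_norm.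
have [ux|n2] := eqVneq u (x - 1).
  have ux' : u + 1 = x by rewrite ux subrK.
  have w3 : `|u + 1 - 1| <= r.+1%:Z by clear -hu; lia.
  have w4 : `|u + 1 + 1| <= r.+1%:Z by clear -hu; lia.
  have [e _] := ring (u + 1) ux' w2 w3 w4.
  rewrite ux push_left -ux -ux' /spread.
  rewrite e (eta_quiet s0 ss' f w0 w1); first last.
  - by case => xu; move: n1; rewrite xu subrK eqxx.
  - by case => xu; move: nx; rewrite xu eqxx.
  apply: (le_trans (circle_dist_triangle (eta s (u + 1)) _ _)).
  rewrite lerD2l; apply: (le_trans (circle_dist_move _ _)).
  by rewrite normrM normr_step ger0_norm.
rewrite push_far// /spread.
rewrite (eta_quiet s0 ss' f w0 w1); first last.
- by case => xu; move: n1; rewrite xu subrK eqxx.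
- by case => xu; move: nx; rewrite xu eqxx.
rewrite (eta_quiet s0 ss' f w2) ?addrK//.
- by case => xu; move: n2; rewrite xu addrK eqxx.
- by case => xu; move: nx; rewrite xu eqxx.
Qed.

(** * The path along a time grid *)

Section grid.
Variables (r : nat) (g : nat -> R) (xs : seq (option int)).
Hypotheses (g_ge0 : 0 <= g 0%N) (g_nd : nondecreasing_seq g).
Hypothesis g_fits : forall i, (i < size xs)%N -> fits r (nth None xs i) (g i) (g i.+1).

Let g_ge0' i : 0 <= g i.
Proof. exact: le_trans g_ge0 (g_nd (leq0n i)). Qed.

Let take_succ i : (i < size xs)%N -> take i.+1 xs = rcons (take i xs) (nth None xs i).
Proof. exact: take_nth. Qed.

Lemma spread_barrier i u : (i <= size xs)%N ->
  spread (g i) u <= barrier r mu (take i xs) u.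
Proof.
elim: i u => [|i IH] u hi; first by rewrite take0; exact: circle_dist_le1.
rewrite take_succ// /barrier -cats1 foldl_cat -/(barrier _ _ _) /= /cap le_min circle_dist_le1/=.
have [hu|hu] := ltP `|u| r%:Z; last first.
  rewrite (_ : drive _ _ _ _ _ = 1) ?circle_dist_le1// /drive.
  by case: nth => [x|] /=; rewrite ?ltNge ?hu/= barrier_outer.
apply: (le_trans (spread_drive (g_ge0' i) (g_nd (leqnSn i)) (g_fits hi) hu)).
by apply: drive_mono => // w; apply: IH; exact: ltnW.
Qed.

Lemma count_fits i u : u \in window r -> n u (g 0%N) = 0%N -> (i <= size xs)%N ->
  n u (g i) = count_mem (Some u) (take i xs).
Proof.
move=> hu n0; elim: i => [|i IH] hi; first by rewrite take0.
rewrite g_fits// IH 1?ltnW// take_succ// -cats1 count_cat /= addn0.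
by rewrite [nth _ _ _ == _]eq_sym eq_sym.
Qed.

(** The silent edges a and c are walls: the opinions at a + 1, ..., c depend on no ring beyond them.
    Outside the walls [evolve] may differ from the path, but this does not propagate inside. *)
Lemma eta_evolve a c i v : a \in window r -> c \in window r ->
  Some a \notin xs -> Some c \notin xs ->
  (forall u, u \in window r -> n u (g 0%N) = 0%N) -> (i <= size xs)%N ->
  a < v <= c -> eta (g i) v = evolve mu b xs i (eta (g 0%N)) v.
Proof.
move=> aw cw axs cxs n0; elim: i v => [//|i IH] v hi hv.
have fi := g_fits hi.
have le_g : g i <= g i.+1 by exact: g_nd.
have nxs x : x = a \/ x = c -> nth None xs i <> Some x.
  by case=> -> e; [move: axs|move: cxs]; rewrite -e mem_nth.
have win u : a <= u <= c -> `|u| <= r.+1%:Z.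
  move: aw cw; rewrite !mem_window; clear; lia.
have wv : `|v| <= r.+1%:Z by apply: win; clear -hv; lia.
have wv1 : `|v - 1| <= r.+1%:Z by apply: win; clear -hv; lia.
rewrite /= /update; case ex : nth => [x|]; last first.
  by rewrite -IH ?(ltnW hi)//; apply: (eta_quiet (g_ge0' i) le_g fi) => //; rewrite ex.
have xa : x <> a by move=> e; apply: (nxs a); [left|rewrite ex e].
have xc : x <> c by move=> e; apply: (nxs c); [right|rewrite ex e].
have quiet : v <> x -> v <> x + 1 -> eta (g i.+1) v = eta (g i) v.
  move=> vx vx1; apply: (eta_quiet (g_ge0' i) le_g fi) => //; rewrite ex => -[e].
    by apply: vx.
  by apply: vx1; rewrite e subrK.
have ring : a < x < c ->
    let sigma := step (b x (count_mem (Some x) (take i.+1 xs))) (eta (g i) x) (eta (g i) (x + 1)) in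
    eta (g i.+1) x = circle_of (circle_val (eta (g i) x) + mu * sigma) /\
    eta (g i.+1) (x + 1) = circle_of (circle_val (eta (g i) (x + 1)) - mu * sigma).
  move=> hx.
  have wx : `|x| <= r.+1%:Z by apply: win; clear -hx; lia.
  rewrite -count_fits ?mem_window//; last by apply: n0; rewrite mem_window.
  apply: eta_ring => //.
  - by apply: fits_quiet fi _ _; [apply: win; clear -hx; lia|rewrite ex; case; clear; lia].
  - by apply: fits_quiet fi _ _; [apply: win; clear -hx; lia|rewrite ex; case; clear; lia].
  - by rewrite fi ?mem_window// ex eqxx addn1.
have [vx|/eqP vx] := eqVneq v x.
  have hx : a < x < c by clear -hv vx xc; lia.
  have [e _] := ring hx; rewrite vx e !IH ?(ltnW hi)//; clear -hx; lia.
have [vx1|/eqP vx1] := eqVneq v (x + 1).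
  have hx : a < x < c by clear -hv vx1 xa; lia.
  have [_ e] := ring hx; rewrite vx1 e !IH ?(ltnW hi)//; clear -hx; lia.
by rewrite quiet// IH// ltnW.
Qed.

End grid.

End path.

(** * Probabilities of the patterns *)

Section partition.
Context d (Omega : measurableType d) (R : realType) (P : probability Omega R).

Lemma measure_setC_pieces (I : eqType) (s : seq I) (A : I -> set Omega) (p : I -> R) :
  uniq s -> (forall i, measurable (A i)) -> trivIset [set` s] A ->
  (forall i, i \in s -> P (A i) = (p i)%:E) ->
  P (~` \big[setU/set0]_(i <- s) A i) = (1 - \sum_(i <- s) p i)%:E.
Proof.
move=> us mA tA pA; set U := \big[setU/set0]_(i <- s) A i.
have mU : measurable U by apply: bigsetU_measurable => i _; exact: mA.
have PU : P U = (\sum_(i <- s) p i)%:E.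
  rewrite -[LHS]mul1e -integral_cst// -sumEFin.
  rewrite (@ge0_integral_bigsetU _ _ _ P _ _ (cst 1%E))//.
  by apply: eq_big_seq => i hi; rewrite integral_cst// mul1e; exact: pA.
by rewrite probability_setC// PU.
Qed.

Lemma abs_integral_pieces (I : eqType) (s : seq I) (A : I -> set Omega)
    (c : I -> R) (X : Omega -> R) (M delta : R) :
  uniq s -> (forall i, measurable (A i)) -> trivIset [set` s] A ->
  measurable_fun setT X -> 0 <= M -> (forall w, `|X w| <= M) ->
  (P (~` \big[setU/set0]_(i <- s) A i) <= delta%:E)%E ->
  (forall i, i \in s -> (`|\int[P]_(w in A i) (X w)%:E| <= (c i)%:E)%E) ->
  (`|\int[P]_w (X w)%:E| <= (\sum_(i <- s) c i + M * delta)%:E)%E.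
Proof.
move=> us mA tA mX M0 XM PU cA.
set U := \big[setU/set0]_(i <- s) A i in PU *.
have mU : measurable U by apply: bigsetU_measurable => i _; exact: mA.
have mXE D : measurable_fun D (EFin \o X).
  by apply/measurable_EFinP; exact: measurable_funTS.
rewrite -(setUv U) integral_setU ?setUv//; first last.
- by apply/disj_setPS => w [].
- exact: measurableC.
apply: (le_trans (lee_abs_add _ _)); rewrite EFinD; apply: leeD.
  rewrite integral_bigsetU_EFin// -sumEFin.
  apply: (le_trans (lee_abs_sum _ _ _)).
  by rewrite big_seq [leRHS]big_seq; apply: lee_sum => i hi; exact: cA.
apply: (le_trans (le_abse_integral _ _ _)) => //; first exact: measurableC.
apply: (le_trans (@integral_le_bound _ _ _ P (~` U) (EFin \o X) M%:E _ _ _ _)) => //.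
- exact: measurableC.
- by apply: aeW => w _ /=; rewrite lee_fin.
by rewrite EFinM; apply: lee_wpmul2l; rewrite ?lee_fin.
Qed.

End partition.

Section nat_process.
Context d (Omega : measurableType d) (R : realType) (P : probability Omega R).
Variable N : R -> {RV P >-> nat}.

Lemma sigma_of_process_increment s t k : 0 <= s -> 0 <= t ->
  sigma_of_process N [set w | (N t w - N s w)%N = k].
Proof.
move=> s0 t0.
pose G := \bigcup_(t in `[0, +oo[) sigma_of (N t).
have mN r (B : set nat) : 0 <= r -> measurable (N r @^-1` B : set (g_sigma_algebraType G)).
  move=> r0; apply: sub_sigma_algebra; exists r; first by rewrite /= in_itv/= r0.
  by exists B => //; rewrite setTI.
have -> : [set w | (N t w - N s w)%N = k] =
    \bigcup_j (N s @^-1` [set j] `&` N t @^-1` [set i | (i - j)%N = k]).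
  apply/seteqP; split => [w <-|w [j _ [/= <- <-]]//].
  by exists (N s w).
apply: (@bigcupT_measurable _ (g_sigma_algebraType G)) => j.
by apply: measurableI; exact: mN.
Qed.

Lemma sigma_of_process_measurable A : sigma_of_process N A -> measurable A.
Proof.
rewrite /sigma_of_process; apply: smallest_sub; first exact: sigma_algebra_measurable.
move=> B [t _ [C mC <-]]; by apply: (@measurable_funPT _ _ _ _ (N t)).
Qed.

End nat_process.

Section pattern_event.
Context d (Omega : measurableType d) (R : realType) (P : probability Omega R).
Variables (N : int -> R -> {RV P >-> nat}) (r : nat) (g : nat -> R).
(** The part of a pattern that concerns one edge: independence of the clocks is applied across
    edges, and independence of increments across steps. *)
Definition clock_event (xs : seq (option int)) (u : int) : set Omega :=
  \bigcap_(i in [set` [fset i in iota 0 (size xs)]%fset])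
    [set w | (N u (g i.+1) w - N u (g i) w)%N = (nth None xs i == Some u)].

(** The subtraction is truncated; it is a true increment on the [regular] outcomes, where the clocks
    are monotone. *)
Definition pattern_event (xs : seq (option int)) : set Omega :=
  [set w | forall u i, u \in window r -> (i < size xs)%N ->
    (N u (g i.+1) w - N u (g i) w)%N = (nth None xs i == Some u)].

Lemma pattern_eventE xs :
  pattern_event xs = \bigcap_(u in [set` [fset u in window r]%fset]) clock_event xs u.
Proof.
apply/seteqP; split => [w h u /=|w h u i hu hi].
  by rewrite inE => hu i /=; rewrite inE mem_iota => /andP[_ hi]; exact: h.
by apply: (h u); rewrite /= inE ?mem_iota.
Qed.

Lemma trivIset_pattern_event k : trivIset [set` patterns r k] pattern_event.
Proof.
move=> xs ys /=; rewrite !patternsP => /andP[/eqP sx ax] /andP[/eqP sy ay] [w [hx hy]].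
apply: (@eq_from_nth _ None); first by rewrite sy.
move=> i hi; have hi' : (i < size ys)%N by rewrite sy -sx.
have ox : nth None xs i \in letters r by apply: (allP ax); exact: mem_nth.
have oy : nth None ys i \in letters r by apply: (allP ay); exact: mem_nth.
have e u : u \in window r -> (nth None xs i == Some u) = (nth None ys i == Some u).
  by move=> hu; have := hx u i hu hi; rewrite (hy u i hu hi'); do 2 case: eqP.
case ex : (nth None xs i) ox => [x|] ox.
  have hx' : x \in window r by move: ox; rewrite inE/= mem_map// => ? ? [].
  by have := e x hx'; rewrite ex eqxx => /esym/eqP.
case ey : (nth None ys i) oy => [y|//] oy.
have hy' : y \in window r by move: oy; rewrite inE/= mem_map// => ? ? [].
by have := e y hy'; rewrite ex ey eqxx => /eqP.
Qed.

Hypotheses (g_ge0 : 0 <= g 0%N) (g_nd : nondecreasing_seq g).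

Let g_ge0' i : 0 <= g i.
Proof. exact: le_trans g_ge0 (g_nd (leq0n i)). Qed.

Lemma clock_event_sigma xs u : sigma_of_process (N u) (clock_event xs u).
Proof.
rewrite /clock_event; apply: (@fin_bigcap_measurable _ (g_sigma_algebraType _)).
  exact: finite_fset.
by move=> i _; exact: sigma_of_process_increment.
Qed.

Lemma measurable_pattern_event xs : measurable (pattern_event xs).
Proof.
rewrite pattern_eventE; apply: fin_bigcap_measurable; first exact: finite_fset.
by move=> u _; exact: (sigma_of_process_measurable (@clock_event_sigma xs u)).
Qed.

Variables (b : int -> nat -> {RV P >-> bool}) (eta0 : {RV P >-> borel (config R)}).
Hypothesis clocks : forall v, poisson_process 1 (N v).
Hypothesis indep : mutual_indep P (driving_sigma N b eta0).

Lemma measure_clock_event tau xs u : 0 < tau -> (forall i, g i.+1 - g i = tau) ->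
  P (clock_event xs u) =
  (\prod_(i < size xs) poisson_pmf tau (nth None xs i == Some u))%:E.
Proof.
move=> tau0 gtau.
rewrite /clock_event (poisson_indep (clocks u) g_ge0 g_nd); last first.
  move=> i _; exists [set (nth None xs i == Some u : nat)] => //.
  by rewrite setTI.
rewrite (eq_bigr (fun i => (poisson_pmf tau (nth None xs i == Some u))%:E)); last first.
  move=> i _; rewrite (poisson_increment (clocks u))//.
    by rewrite mul1r gtau.
  by rewrite -subr_gt0 gtau.
rewrite prodEFin; congr EFin.
rewrite -[RHS](big_mkord xpredT (fun i => poisson_pmf tau (nth None xs i == Some u))).
apply: perm_big; rewrite /index_iota subn0.
apply: uniq_perm; [exact: fset_uniq|exact: iota_uniq|].
by move=> i; rewrite inE.
Qed.

(** After exchanging the products over edges and over steps, each step contributes exp (- tau) for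
    every silent edge and tau exp (- tau) for the ringing one. *)
Lemma measure_pattern_event tau xs : 0 < tau -> (forall i, g i.+1 - g i = tau) ->
  all (mem (letters r)) xs ->
  P (pattern_event xs) =
  (pattern_weight (expR (- (tau * (2 * r + 3)%:R))) tau xs)%:E.
Proof.
move=> tau0 gtau hxs.
(* The clocks are some of the sources of [driving_sigma]; [unidx] reads the edge back, with the
   default 0 at the other sources. *)
pose idx (u : int) : unit + int + int * nat := inl (inr u).
pose unidx (i : unit + int + int * nat) : int := if i is inl (inr u) then u else 0.
have -> : pattern_event xs =
    \bigcap_(i in [set` [fset idx u | u in window r]%fset]) clock_event xs (unidx i).
  rewrite pattern_eventE; apply/seteqP; split => w h.
    by move=> _ /= /imfsetP[u /= hu ->]; apply: h; rewrite /= inE.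
  by move=> u /=; rewrite inE => hu; apply: (h (idx u)); exact: in_imfset.
rewrite indep; last first.
  by move=> _ /= /imfsetP[u /= hu ->]; exact: clock_event_sigma.
rewrite (perm_big [seq idx u | u <- window r]); last first.
  apply: uniq_perm; first exact: fset_uniq.
    by rewrite map_inj_uniq ?uniq_window// => ? ? [].
  move=> i; apply/imfsetP/mapP => -[u hu ->]; by exists u.
rewrite big_map/=.
under eq_bigr do rewrite (measure_clock_event _ _ tau0 gtau).
rewrite prodEFin; congr EFin.
rewrite exchange_big/= /pattern_weight (big_nth None) big_mkord.
apply: eq_bigr => i _.
have : nth None xs i \in letters r by apply: (allP hxs); exact: mem_nth.
have pmf0 : poisson_pmf tau 0 = expR (- tau).
  by rewrite /poisson_pmf tau0 expr0 fact0 invr1 !mul1r.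
have pmf1 : poisson_pmf tau 1 = tau * expR (- tau).
  by rewrite /poisson_pmf tau0 expr1 factS fact0 muln1 invr1 mulr1.
have expE : expR (- (tau * (2 * r + 3)%:R)) = expR (- tau) ^+ size (window r).
  by rewrite size_window -mulNr expRM_natr.
have const (s : seq int) : \prod_(u <- s) expR (- tau) = expR (- tau) ^+ size s.
  by rewrite big_const_seq count_predT iter_mulr_1.
case: nth => [x|] /= hx; last by rewrite expE -const; apply: eq_bigr => u _.
have {}hx : x \in window r by move: hx; rewrite inE/= mem_map// => ? ? [].
rewrite expE -const (bigD1_seq x) ?uniq_window//= eqxx pmf1.
rewrite [X in _ = X * _](bigD1_seq x) ?uniq_window//= -mulrA [LHS]mulrC.
congr (_ * _ * _); apply: eq_bigr => u /negPf ux.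
by rewrite (_ : (Some x == Some u) = false) ?pmf0//; apply/eqP => -[e]; rewrite e eqxx in ux.
Qed.

End pattern_event.

Lemma continuous_borel_measurable (R : realType) (T : ptopologicalType) (f : T -> R) :
  continuous f -> measurable_fun [set: borel T] (f : borel T -> R).
Proof.
move=> /continuousP cf; apply: (measurability _ (RGenOInfty.measurableE R)).
move=> _ [_ [a ->] <-]; rewrite setTI; apply: sub_sigma_algebra.
exact/cf/interval_open.
Qed.

Section projections.
Context (R : realType).

Lemma continuous_coord (v : int) : continuous (fun z : config R => z v).
Proof. exact: (@proj_continuous int (fun=> circle R) v). Qed.

Lemma continuous_circle_dist (T : topologicalType) (f g : T -> circle R) :
  continuous f -> continuous g -> continuous (fun x => circle_dist (f x) (g x)).
Proof.
move=> cf cg x; apply/cvgrPdist_lt => e e0.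
have e2 : 0 < e / 2 by rewrite divr_gt0.
near=> y.
have hf : circle_dist (f x) (f y) < e / 2.
  have : ball (f x) (e / 2) (f y) by near: y; apply: (cf x); exact: nbhsx_ballx.
  by rewrite ballEmdist.
have hg : circle_dist (g x) (g y) < e / 2.
  have : ball (g x) (e / 2) (g y) by near: y; apply: (cg x); exact: nbhsx_ballx.
  by rewrite ballEmdist.
have h1 := circle_dist_triangle (f y) (f x) (g x).
have h2 := circle_dist_triangle (g y) (f y) (g x).
have h3 := circle_dist_triangle (f x) (f y) (g y).
have h4 := circle_dist_triangle (g x) (f x) (g y).
rewrite (circle_distC (f y) (f x)) in h3; rewrite (circle_distC (g y) (g x)) in h2.
by rewrite ltr_norml; apply/andP; split; lra.
Unshelve. all: by end_near. Qed.

End projections.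

(** * The expected distances of neighbours tend to 0 *)

Section consensus.
Context (R : realType) (mu : R) (mu_gt0 : 0 < mu) (mu_le : mu <= 2^-1).
Context d (Omega : measurableType d) (P : probability Omega R).
Context (N : int -> R -> {RV P >-> nat}) (b : int -> nat -> {RV P >-> bool}).
Context (eta : R -> {RV P >-> borel (config R)}).
Hypothesis model : compass_model mu N b eta.

Definition regular w :=
  [/\ forall v, clock_path (fun t => N v t w), forall v, N v 0 w = 0%N &
      compass_path mu (fun v t => N v t w) (fun v k => b v k w) (fun t => eta t w)].

Lemma ae_forall_int (Q : int -> Omega -> Prop) :
  (forall v, {ae P, forall w, Q v w}) -> {ae P, forall w, forall v, Q v w}.
Proof.
move=> h.
have : {ae P, forall w, forall n : nat, oapp (fun v => Q v w) True (@choice.unpickle int n)}.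
  apply: ae_foralln => n; case: (choice.unpickle n) => [v|] /=; first exact: h.
  exact: aeW.
by apply: filterS => w hw v; have := hw (choice.pickle v); rewrite choice.pickleK.
Qed.

Lemma ae_regular : {ae P, forall w, regular w}.
Proof.
have h : {ae P, forall w, forall v,
    clock_path (fun t => N v t w) /\ N v 0 w = 0%N}.
  apply: ae_forall_int => v.
  apply: filterS (poisson_path (compass_clocks model v)) => w [n0 mono rc].
  by split => //; split.
apply: filterS2 h (compass_paths model) => w hw path.
by split => // v; case: (hw v).
Qed.

Lemma pattern_event_fits r g xs w : 0 <= g 0%N -> nondecreasing_seq g -> regular w ->
  pattern_event N r g xs w -> forall i, (i < size xs)%N ->
  fits (fun v t => N v t w) r (nth None xs i) (g i) (g i.+1).
Proof.
move=> g0 gnd [clock _ _] hw i hi u hu; rewrite -(hw u i hu hi) subnKC//.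
by apply: (clock u).1; [exact: le_trans g0 (gnd _ _ _)|exact: gnd].
Qed.

Lemma measurable_spread t v :
  measurable_fun setT (fun w => spread (fun t => eta t w) t v).
Proof.
have c : continuous (fun z : config R => circle_dist (z v) (z (v + 1))).
  by apply: continuous_circle_dist; exact: continuous_coord.
exact: (measurableT_comp (continuous_borel_measurable c) (measurable_funPT (eta t))).
Qed.

Lemma expR_step_probability (x : R) : 0 <= x ->
  [/\ 0 <= expR (- x), 1 - x <= expR (- x) & expR (- x) * (1 + x) <= 1].
Proof.
move=> x0; split; first exact: expR_ge0.
  by apply: le_trans (expR_ge1Dx _); rewrite lexx.
rewrite expRN mulrC ler_pdivrMr ?expR_gt0// mul1r; exact: expR_ge1Dx.
Qed.

(** With x = tau L, a step has several rings with probability 1 - exp (- x) (1 + x), at most x ^ 2;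
    these bounds add up over j steps. *)
Lemma one_sub_average1_le r (tau : R) j : 0 <= tau ->
  1 - average r (expR (- (tau * (2 * r + 3)%:R))) tau j (fun=> 1) <=
  j%:R * (tau * (2 * r + 3)%:R) ^+ 2.
Proof.
move=> tau0; rewrite average1.
have x0 : 0 <= tau * (2 * r + 3)%:R by rewrite mulr_ge0.
have [q0 qge qle] := expR_step_probability x0.
set x := _ * _%:R in q0 qge qle *; set q := expR _ in q0 qge qle *.
have y0 : 0 <= q * (1 + x) by rewrite mulr_ge0// addr_ge0.
have y1 : 1 - x ^+ 2 <= q * (1 + x).
  have : (1 - x) * (1 + x) <= q * (1 + x) by rewrite ler_wpM2r// addr_ge0.
  by apply: le_trans; rewrite le_eqVlt; apply/orP; left; apply/eqP; ring.
elim: j => [|j IH]; first by rewrite expr0 subrr mul0r.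
rewrite exprS -natr1.
have : 0 <= (q * (1 + x)) ^+ j by rewrite exprn_ge0.
have : (q * (1 + x)) ^+ j <= 1 by rewrite exprn_ile1.
move: (q * (1 + x)) y0 y1 qle IH => y y0 y1 qle IH h1 h2.
have h3 : (1 - y) * (y ^+ j) <= x ^+ 2.
  apply: (@le_trans _ _ (1 - y)); last by lra.
  by rewrite ler_piMr// subr_ge0.
by rewrite mulrBl mul1r in h3; lra.
Qed.

(** Only the last T units of time before t are observed: the barrier starts from 1 and bounds the
    distance whatever the configuration at time t - T. *)
Lemma spread_vanish v (eps : R) : 0 < eps -> exists T : nat, forall t, T%:R <= t ->
  (`|\int[P]_w (spread (fun t => eta t w) t v)%:E| <= eps%:E)%E.
Proof.
move=> eps0; have e2 : 0 < eps / 2 by rewrite divr_gt0.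
have [T [r [k0 hk0]]] := average_barrier_le mu_gt0 mu_le v e2.
exists T => t Tt.
pose C : R := T%:R * (2 * r + 3)%:R ^+ 2.
(* The weight of the patterns left out is at most T k (tau L) ^ 2 = C / k, which this k makes at
   most eps / 2. *)
pose k := maxn k0 (maxn 1 (Num.truncn (2 * C / eps)).+1).
have k1 : (0 < k)%N by rewrite /k !leq_max ltnS leqnn !orbT.
have kk0 : (k0 <= k)%N by rewrite leq_max leqnn.
have kC : 2 * C / eps <= k%:R.
  apply: (le_trans (ltW (truncnS_gt _))).
  by rewrite ler_nat /k !leq_max leqnn !orbT.
have kR : 0 < k%:R :> R by rewrite ltr0n.
pose tau : R := k%:R^-1.
have tau0 : 0 < tau by rewrite invr_gt0.
pose s := t - T%:R.
have s0 : 0 <= s by rewrite subr_ge0.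
pose g i : R := s + i%:R * tau.
have g0 : 0 <= g 0%N by rewrite /g mul0r addr0.
have gS i : g i.+1 - g i = tau by rewrite /g -natr1; ring.
have gnd : nondecreasing_seq g.
  by move=> i j ij; rewrite lerD2l ler_wpM2r ?ler_nat// ltW.
have gT : g (T * k)%N = t.
  by rewrite /g natrM mulfK ?subrK// gt_eqF.
pose q := expR (- (tau * (2 * r + 3)%:R)).
have hq : step_probability r k q.
  by apply: expR_step_probability; rewrite mulr_ge0// ltW.
have [q0 _ _] := hq.
have Pxs xs : xs \in patterns r (T * k) ->
    P (pattern_event N r g xs) = (pattern_weight q tau xs)%:E.
  rewrite patternsP => /andP[_ hxs].
  exact: (measure_pattern_event g0 gnd (compass_clocks model) (compass_indep model)).
have tU := @trivIset_pattern_event _ _ _ _ N r g (T * k).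
have mA := measurable_pattern_event N r g0 gnd.
have PU := measure_setC_pieces (uniq_patterns _ _) mA tU Pxs.
have pieces := @abs_integral_pieces _ _ _ P _ (patterns r (T * k))
  (pattern_event N r g) (fun xs => pattern_weight q tau xs * barrier r mu xs v)
  _ 1 _ (uniq_patterns _ _) mA tU (measurable_spread t v) ler01.
apply: (le_trans (pieces (1 - \sum_(xs <- patterns r (T * k)) pattern_weight q tau xs) _ _ _)).
- by move=> w; rewrite ger0_norm ?circle_dist_ge0// circle_dist_le1.
- by rewrite PU.
- move=> xs hxs.
  have [/eqP sxs axs] : size xs == (T * k)%N /\ all (mem (letters r)) xs.
    by move: hxs; rewrite patternsP => /andP.
  have mf : measurable_fun (pattern_event N r g xs)
      (EFin \o (fun w => spread (fun t => eta t w) t v)).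
    by apply/measurable_EFinP; apply: measurable_funTS; exact: measurable_spread.
  apply: (le_trans (le_abse_integral _ (mA xs) mf)).
  apply: (le_trans (@integral_le_bound _ _ _ P _ _ (barrier r mu xs v)%:E (mA xs) mf _ _)).
  + by rewrite lee_fin barrier_ge0// ltW.
  + apply: filterS ae_regular => w hw hA /=.
    rewrite lee_fin ger0_norm ?circle_dist_ge0//.
    have [clock _ path] := hw.
    have := spread_barrier clock path (ltW mu_gt0) mu_le g0 gnd
      (pattern_event_fits g0 gnd hw hA) v (leqnn _).
    by rewrite take_size sxs gT.
  + rewrite muleC [X in (X * _)%E](_ : _ = (pattern_weight q tau xs)%:E)//.
    exact: Pxs.
rewrite lee_fin mul1r.
have := one_sub_average1_le r (T * k) (ltW tau0); rewrite /average -/tau -/q.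
have := hk0 k kk0 q hq; rewrite /average -/tau.
under [X in 1 - X]eq_bigr do rewrite mulr1.
move=> h1 h2.
have h3 : (T * k)%:R * (tau * (2 * r + 3)%:R) ^+ 2 <= eps / 2.
  rewrite [leLHS](_ : _ = C / k%:R); last first.
    by rewrite /C /tau natrM; field; rewrite gt_eqF.
  rewrite ler_pdivrMr//; move: kC; rewrite ler_pdivrMr//; lra.
lra.
Qed.

End consensus.

(** * Rotations *)

Section rotation.
Context (R : realType).
Implicit Types (s : R) (z u v : circle R).

Definition turn s z : circle R := circle_of (circle_val z + s).

Definition rotate s (x : config R) : config R := fun k => turn s (x k).

(** Addition on the circle is commutative, which lets an angle and an opinion exchange their roles
    in [integral_equivariant]. *)
Lemma turn_valC u v : turn (circle_val u) v = turn (circle_val v) u.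
Proof. by rewrite /turn addrC. Qed.

Lemma turn_move s z (d : R) :
  circle_of (circle_val (turn s z) + d) = turn s (circle_of (circle_val z + d)).
Proof. by rewrite /turn /= !circle_of_repD addrAC. Qed.

Lemma step_turn b s u v : step b (turn s u) (turn s v) = step b u v.
Proof.
rewrite /step /=.
have [k ->] := circle_repE (circle_val v + s).
have [l ->] := circle_repE (circle_val u + s).
rewrite (_ : _ - _ = circle_val v - circle_val u + 2 * (k - l)%:~R) ?circle_repDz//.
by rewrite intrB; ring.
Qed.

Lemma update_rotate mu bit o s (x : config R) :
  update mu bit o (rotate s x) = rotate s (update mu bit o x).
Proof.
case: o => [y|] //=; apply/funext => v; rewrite /rotate step_turn.
by case: eqP => _; [rewrite turn_move|case: eqP => _; rewrite ?turn_move].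
Qed.

Lemma evolve_rotate mu b xs i s (x : config R) :
  evolve mu b xs i (rotate s x) = rotate s (evolve mu b xs i x).
Proof. by elim: i => [//|i IH] /=; rewrite IH update_rotate. Qed.

End rotation.

(** * Measurability on the circle *)

Section circle_measurable.
Context (R : realType).

Lemma open_circle_interval (a : R) : -1 <= a ->
  open [set z : circle R | a < circle_val z < 1].
Proof.
move=> a1; rewrite openE => z /= /andP[az z1].
apply/nbhs_ballP; exists (Num.min (circle_val z - a) (1 - circle_val z)) => /=.
  by rewrite lt_min !subr_gt0 az.
rewrite ballEmdist => y /=; rewrite lt_min /mdist/= /circle_dist.
rewrite !gt_min; case: y => y /andP[y1 y2] /=.
move: (circle_val z) az z1 => x az z1.
by case: (ger0P (x - y)) => h /andP[] /orP[] h1 /orP[] h2; apply/andP; split; lra.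
Qed.

(** [circle_val] is discontinuous at the point 1, where the circle is cut: a half-line starting in
    [-1, 1[ pulls back to an open arc together with that point. *)
Lemma measurable_circle_val :
  measurable_fun [set: borel (circle R)] (@circle_val R : borel (circle R) -> R).
Proof.
apply: (measurability _ (RGenOInfty.measurableE R)) => _ [_ [a ->] <-]; rewrite setTI.
have mo b : -1 <= b -> measurable ([set z | b < circle_val z < 1] : set (borel (circle R))).
  by move=> b1; apply: sub_sigma_algebra; exact: open_circle_interval.
have m1 : measurable ([set z | circle_val z = 1] : set (borel (circle R))).
  rewrite (_ : mkset _ = ~` [set z | -1 < circle_val z < 1]).
    by apply: measurableC; exact: mo.
  apply/seteqP; split => z /=; first by move=> ->; rewrite ltxx andbF.
  case: z => x /= /andP[x1 x2] /negP; rewrite x1/= -leNgt => x3.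
  by apply/eqP; rewrite eq_le x2.
have [a1|a1] := leP 1 a.
  rewrite (_ : _ @^-1` _ = set0) ?measurable0//.
  apply/seteqP; split => z //=; rewrite in_itv/= andbT.
  by case: z => x /= /andP[_ x2]; rewrite ltNge (le_trans x2 a1).
have [a2|a2] := leP (-1) a.
  rewrite (_ : _ @^-1` _ = [set z | a < circle_val z < 1] `|` [set z | circle_val z = 1]).
    by apply: measurableU => //; exact: mo.
  apply/seteqP; split => z /=; rewrite in_itv/= andbT.
    move=> az; have [z1|z1] := ltP (circle_val z) 1; first by left; rewrite az.
    right; apply/eqP; rewrite eq_le z1 andbT.
    by case: z {az z1} => x /= /andP[].
  by case=> [/andP[]//|->].
rewrite (_ : _ @^-1` _ = setT) ?measurableT//.
apply/seteqP; split => z //= _; rewrite in_itv/= andbT.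
by case: z => x /= /andP[x1 _]; exact: lt_trans x1.
Qed.

Lemma measurable_circle_of :
  measurable_fun [set: R] (@circle_of R : R -> borel (circle R)).
Proof.
apply: (@measurability _ _ _ (borel (circle R)) setT
  (@circle_of R) (@open (circle R))) => // _ [B oB <-].
rewrite setTI; apply: open_measurable.
by apply: open_comp => // x _; exact: continuous_circle_of.
Qed.

Lemma measurable_circle_rep : measurable_fun [set: R] (@circle_rep R).
Proof.
apply: measurable_funB => //; apply: measurable_funM => //.
have mc : measurable_fun [set: R] (fun x : R => (Num.ceil x)%:~R : R).
  by apply: nondecreasing_measurable => // x y xy; rewrite ler_int le_ceil.
apply: (measurableT_comp mc); apply: measurable_funM => //.
exact: measurable_funB.
Qed.

Context d (T : measurableType d).
Implicit Types phi psi : T -> borel (circle R).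

Lemma measurable_step (b : bool) phi psi : measurable_fun setT phi ->
  measurable_fun setT psi -> measurable_fun setT (fun x => step b (phi x) (psi x)).
Proof.
move=> mphi mpsi; rewrite /step.
have mdelta : measurable_fun setT
    (fun x => circle_rep (circle_val (psi x) - circle_val (phi x))).
  apply: (measurableT_comp measurable_circle_rep); apply: measurable_funB.
    exact: (measurableT_comp measurable_circle_val mpsi).
  exact: (measurableT_comp measurable_circle_val mphi).
apply: measurable_fun_ifT => //.
by apply: measurable_fun_eqr.
Qed.

Lemma measurable_circle_shift phi (g : T -> R) : measurable_fun setT phi ->
  measurable_fun setT g ->
  measurable_fun setT (fun x => circle_of (circle_val (phi x) + g x) : borel (circle R)).
Proof.
move=> mphi mg; apply: (measurableT_comp measurable_circle_of).
by apply: measurable_funD => //; exact: (measurableT_comp measurable_circle_val mphi).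
Qed.

End circle_measurable.

(** * Rotation invariance of Lebesgue measure on a period *)

Section lebesgue.
Context (R : realType).
Local Notation leb := (@lebesgue_measure R).

Lemma lebesgue_measure_shift (a : R) (A : set R) : measurable A ->
  leb ((fun x => x + a) @^-1` A) = leb A.
Proof.
have mshift : measurable_fun [set: R] ((fun x => x + a) : R -> measurableTypeR R).
  exact: measurable_funD.
move=> mA; rewrite -/(pushforward leb ((fun x => x + a) : R -> measurableTypeR R) A).
apply/esym/lebesgue_measure_unique => //= _ [[u v]] _ <-.
rewrite /pushforward /= (_ : _ @^-1` _ = `]u - a, v - a]%classic).
  rewrite !lebesgue_measure_itv/= !lte_fin ltrD2r; case: ifP => // _.
  by rewrite -!EFinB; congr EFin; ring.
by apply/seteqP; split => x /=; rewrite !in_itv/= ltrBlDr lerBrDr.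
Qed.

(** The preimage E of [B] has period 2, so it has the same measure in every interval of length 2;
    the shift by s replaces ]-1, 1] by ]s - 1, s + 1]. *)
Lemma lebesgue_measure_turn (s : R) (B : set (borel (circle R))) : measurable B ->
  leb ((fun x => circle_of (x + s)) @^-1` B `&` `](-1), 1]) =
  leb (@circle_of R @^-1` B `&` `](-1), 1]).
Proof.
move=> mB; pose E : set R := @circle_of R @^-1` B.
have mE : measurable E by rewrite -[E]setTI; exact: measurable_circle_of.
have EDz x (k : int) : E (x + 2 * k%:~R) = E x by rewrite /E /= circle_ofDz.
have E2 x : E (x + 2) = E x by rewrite -(EDz x 1) mulr1.
(* Modulo 2 the angle can be taken in ]0, 2]; then s - 1 lies in ]-1, 1]. *)
wlog sb : s / 0 < s <= 2.
  move=> H; pose s' := circle_rep (s - 1) + 1.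
  have [k e] := circle_repE (s - 1).
  rewrite -(H s'); last first.
    by have /andP[h1 h2] := circle_repP (s - 1); apply/andP; split; rewrite /s'; lra.
  congr (leb (_ `&` _)); apply/funext => x /=.
  rewrite (_ : x + s' = x + s + 2 * k%:~R) ?circle_ofDz//.
  by rewrite /s' e; ring.
have /andP[s0 s2] := sb.
have mI a c : measurable (E `&` `]a, c]) by exact: measurableI.
have split_measure a b c : a <= b -> b <= c ->
    leb (E `&` `]a, c]) = (leb (E `&` `]a, b]) + leb (E `&` `]b, c]))%E.
  move=> ab bc; rewrite -measureU; [|exact: mI|exact: mI|].
    rewrite -setIUr (_ : `]a, b]%classic `|` `]b, c]%classic = `]a, c]%classic)//.
    apply/seteqP; split => x /=; rewrite !in_itv/=.
      by case=> /andP[h1 h2]; apply/andP; split; lra.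
    by move=> /andP[h1 h2]; have [h|h] := leP x b; [left|right]; rewrite ?h1 ?h2 ?h.
  apply/seteqP; split => x //= -[[_ +] [_ +]]; rewrite /= !in_itv/=.
  by move=> /andP[_ h1] /andP[h2 _]; move: (le_lt_trans h1 h2); rewrite ltxx.
rewrite (split_measure (-1) (s - 1) 1); [|lra|lra].
(* The part to the left of s - 1 is moved by one period to the right end. *)
have -> : leb (E `&` `](-1), (s - 1)]) = leb (E `&` `]1, (s + 1)]).
  rewrite -(lebesgue_measure_shift 2 (mI 1 (s + 1))); congr (leb _).
  apply/seteqP; split => x /=; rewrite !in_itv/= => -[Ex /andP[h1 h2]].
    by split; [change (E (x + 2)); rewrite E2|apply/andP; split; lra].
  by split; [change (E (x + 2)) in Ex; rewrite -E2|apply/andP; split; lra].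
rewrite addeC -split_measure; [|lra|lra].
rewrite -[RHS](lebesgue_measure_shift s (mI _ _)).
congr (leb _); apply/seteqP; split => x /=; rewrite !in_itv/=.
  by move=> [Ex /andP[h1 h2]]; split => //; apply/andP; split; lra.
by move=> [Ex /andP[h1 h2]]; split => //; apply/andP; split; lra.
Qed.

End lebesgue.

(** Uniqueness of finite measures on a pi-system, applied to the two image measures. *)
Lemma ge0_eq_integral_comp d1 d2 (X : measurableType d1) (Y : measurableType d2)
    (R : realType) (mu : {measure set X -> \bar R}) (G : set_system Y)
    (phi psi : X -> Y) (f : Y -> \bar R) :
  measurable = <<s G >> -> setI_closed G -> G setT -> (mu setT < +oo)%E ->
  measurable_fun setT phi -> measurable_fun setT psi ->
  (forall A, G A -> mu (phi @^-1` A) = mu (psi @^-1` A)) ->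
  measurable_fun setT f -> (forall y, (0 <= f y)%E) ->
  (\int[mu]_x f (phi x) = \int[mu]_x f (psi x))%E.
Proof.
move=> mG GI GT mufin mphi mpsi eqG mf f0.
have := @ge0_integral_pushforward _ _ X Y R phi mphi mu setT f measurableT mf (fun y _ => f0 y).
rewrite preimage_setT => <-.
have := @ge0_integral_pushforward _ _ X Y R psi mpsi mu setT f measurableT mf (fun y _ => f0 y).
rewrite preimage_setT => <-.
apply: eq_measure_integral => A mA _.
apply: (measure_unique G (fun=> setT)) => //.
by rewrite bigcup_const.
Qed.

Lemma ge0_integral_restr d (T : measurableType d) (R : realType)
    (mu : {measure set T -> \bar R}) (D : set T) (mD : measurable D) (f : T -> \bar R) :
  measurable_fun setT f -> (forall x, (0 <= f x)%E) ->
  (\int[mu]_(x in D) f x = \int[mrestr mu mD]_x f x)%E.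
Proof.
move=> mf f0.
rewrite [RHS](@ge0_negligible_integral _ _ _ (mrestr mu mD) setT (~` D))//; last 2 first.
- exact: measurableC.
- by rewrite /= /mrestr setICl measure0.
rewrite setTD setCK; apply: eq_measure_integral => A mA AD /=.
by rewrite /mrestr setIidl.
Qed.

(** * Cylinder sets of configurations *)

Section cylinder.
Context (R : realType).

(** Rectangles with finitely many constrained coordinates: a pi-system of Borel sets on which an
    i.i.d. law is a product. *)
Definition cylinder : set_system (config R) :=
  [set A | exists (J : seq int) (B : int -> set (borel (circle R))),
    (forall v, measurable (B v)) /\ A = [set z | forall v, v \in J -> B v (z v)]].

Local Notation T := (g_sigma_algebraType cylinder).

Lemma cylinderT : cylinder setT.
Proof.
exists [::], (fun=> setT); split => //; apply/seteqP; split => z //= _ v.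
Qed.

Lemma cylinderI : setI_closed cylinder.
Proof.
move=> _ _ [J [B [mB ->]]] [K [C [mC ->]]].
exists (J ++ K), (fun v => (if v \in J then B v else setT) `&` (if v \in K then C v else setT)).
split; first by move=> v; apply: measurableI; case: ifP.
apply/seteqP; split => z /=.
  by move=> [h1 h2] v _; split; case: ifP => // hv; [exact: h1|exact: h2].
move=> h; split => v hv; have := h v; rewrite mem_cat hv ?orbT/= => /(_ isT) [];
  by rewrite ?hv.
Qed.

Lemma measurable_coord v : measurable_fun [set: T] (fun z : T => z v : borel (circle R)).
Proof.
move=> _ B mB; rewrite setTI; apply: sub_sigma_algebra.
exists [:: v], (fun=> B); split => //; apply/seteqP; split => z /=.
  by move=> h u; rewrite inE => /eqP ->.
by apply; rewrite mem_head.
Qed.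

Lemma measurable_evolve mu b xs i v :
  measurable_fun [set: T] (fun z : T => evolve mu b xs i z v : borel (circle R)).
Proof.
elim: i v => [|i IH] v /=; first exact: measurable_coord.
rewrite /update; case: nth => [x|]; last exact: IH.
case: eqP => _.
  by apply: measurable_circle_shift => //; apply: measurable_funM => //; exact: measurable_step.
case: eqP => _; last exact: IH.
apply: (@measurable_circle_shift _ _ _ _ (fun z => - _)) => //.
by apply: measurableT_comp => //; apply: measurable_funM => //; exact: measurable_step.
Qed.

Lemma measurable_borel_coord v :
  measurable_fun [set: borel (config R)] (fun z : borel (config R) => z v : borel (circle R)).
Proof.
apply: (@measurability _ _ (borel (config R)) (borel (circle R)) setT _ (@open (circle R))) => //.
move=> _ [B oB <-]; rewrite setTI; apply: sub_sigma_algebra.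
by apply: open_comp => // z _; exact: continuous_coord.
Qed.

Lemma measurable_cylinder_borel (A : set (config R)) : cylinder A ->
  measurable (A : set (borel (config R))).
Proof.
move=> [J [B [mB ->]]].
rewrite (_ : mkset _ = \bigcap_(v in [set` [fset v in J]%fset]) ((fun z : borel (config R) => z v) @^-1` B v)).
  apply: fin_bigcap_measurable; first exact: finite_fset.
  by move=> v _; rewrite -[X in measurable X]setTI; exact: measurable_borel_coord.
apply/seteqP; split => z /= h v; first by rewrite /= inE => /h.
by move=> hv; apply: (h v); rewrite /= inE.
Qed.

Lemma measurable_cylinder_fun d (Omega : measurableType d)
    (phi : {mfun Omega >-> borel (config R)}) :
  measurable_fun [set: Omega] (phi : Omega -> T).
Proof.
apply: (@measurability _ _ Omega T setT _ cylinder) => // _ [A cA <-].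
exact: (measurable_funPT phi measurableT _ (measurable_cylinder_borel cA)).
Qed.

Lemma cylinder_rotate s A : cylinder A -> cylinder (@rotate R s @^-1` A).
Proof.
move=> [J [B [mB ->]]].
exists J, (fun v => (fun z => turn s z : borel (circle R)) @^-1` B v); split => // v.
rewrite -[X in measurable X]setTI.
exact: (measurable_circle_shift (@measurable_id _ _ setT) (measurable_cst s)).
Qed.

End cylinder.

(** * Rotation invariance of the i.i.d. uniform law *)

Section uniform.
Context (R : realType) d (Omega : measurableType d) (P : probability Omega R).
Variable xi : {RV P >-> borel (config R)}.
Hypothesis xi_uniform : iid_uniform P xi.

Lemma uniform_turn v s (B : set (borel (circle R))) : measurable B ->
  P [set w | B (turn s (xi w v))] = P [set w | B (xi w v)].
Proof.
move=> mB; case: xi_uniform => _ h.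
have m1 : measurable ((fun x => circle_of (x + s)) @^-1` B).
  rewrite -[X in measurable X]setTI.
  by apply: (measurableT_comp (@measurable_circle_of R)) => //; exact: measurable_funD.
have m2 : measurable (@circle_of R @^-1` B).
  by rewrite -[X in measurable X]setTI; exact: measurable_circle_of.
have := h v _ m1; rewrite /= => ->.
rewrite lebesgue_measure_turn// -(h v _ m2); congr (P _).
by apply/funext => w /=; rewrite circle_valK.
Qed.

Lemma measure_cylinder (J : seq int) (B : int -> set (borel (circle R))) :
  (forall v, measurable (B v)) ->
  P (xi @^-1` [set z | forall v, v \in J -> B v (z v)]) =
  (\prod_(v <- [fset v in J]%fset) P [set w | B v (xi w v)])%E.
Proof.
move=> mB; case: xi_uniform => indep _.
rewrite -indep; last by move=> v _; exists (B v) => //; rewrite setTI.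
congr (P _); apply/seteqP; split => w /= h v; first by rewrite /= inE => /h.
by move=> hv; apply: (h v); rewrite /= inE.
Qed.

Lemma law_rotate s (A : set (config R)) : cylinder A ->
  P (xi @^-1` (@rotate R s @^-1` A)) = P (xi @^-1` A).
Proof.
move=> [J [B [mB ->]]]; rewrite measure_cylinder//.
rewrite [LHS](measure_cylinder J (B := fun v => (fun z => turn s z : borel (circle R)) @^-1` B v)).
  by apply: eq_bigr => v _; exact: uniform_turn.
move=> v; rewrite -[X in measurable X]setTI.
exact: (measurable_circle_shift (@measurable_id _ _ setT) (measurable_cst s)).
Qed.

(* Rotating by the value of [xi] at 0 in an independent copy of the probability
   space turns the law of an equivariant functional into the law of a single
   uniform opinion. *)
Lemma integral_equivariant (D : set Omega) (Phi : config R -> circle R) (f : circle R -> R) :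
  measurable D ->
  (forall A : set (borel (config R)), measurable A ->
    P (xi @^-1` A `&` D) = P (xi @^-1` A) * P D)%E ->
  measurable_fun [set: g_sigma_algebraType (@cylinder R)]
    (Phi : g_sigma_algebraType (@cylinder R) -> borel (circle R)) ->
  (forall s z, Phi (rotate s z) = turn s (Phi z)) ->
  continuous f -> (forall z, 0 <= f z) ->
  (\int[P]_(w in D) (f (Phi (xi w)))%:E = (\int[P]_w (f (xi w 0))%:E) * P D)%E.
Proof.
move=> mD indep mPhi equiv cf f0.
pose T := g_sigma_algebraType (@cylinder R).
have mphi (phi : Omega -> T) :
    (forall A, cylinder A -> measurable (phi @^-1` A)) -> measurable_fun setT phi.
  move=> h; apply: (@measurability _ _ Omega T setT _ (@cylinder R)) => // _ [A cA <-].
  by rewrite setTI; exact: h.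
have mxiA A : cylinder A -> measurable (xi @^-1` A).
  move=> /measurable_cylinder_borel mA; rewrite -[X in measurable X]setTI.
  exact: (measurable_funPT xi measurableT _ mA).
have mxi : measurable_fun [set: Omega] (xi : Omega -> T) by exact: mphi.
have mxis s : measurable_fun [set: Omega] ((fun w => rotate s (xi w)) : Omega -> T).
  by apply: mphi => A /(cylinder_rotate s)/mxiA.
have mf := continuous_borel_measurable cf.
have mg : measurable_fun [set: T] (fun z : T => (f (Phi z))%:E).
  by apply/measurable_EFinP; exact: (measurableT_comp mf mPhi).
have mg0 : measurable_fun [set: T] (fun z : T => (f (z 0))%:E).
  by apply/measurable_EFinP; exact: (measurableT_comp mf (@measurable_coord R 0)).
pose m : {measure set Omega -> \bar R} := mrestr P mD.
have PD : (P D < +oo)%E by rewrite -ge0_fin_numE// fin_num_measure.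
have mT : (m setT < +oo)%E by rewrite /m /= /mrestr setTI.
(* By independence, under P restricted to [D] the law of [xi] is P D times its own law, hence still
   invariant under rotations. *)
have step1 s : (\int[m]_w (f (Phi (xi w)))%:E = \int[m]_w (f (turn s (Phi (xi w))))%:E)%E.
  under [RHS]eq_integral do rewrite -equiv.
  apply: (@ge0_eq_integral_comp _ _ Omega T R m (@cylinder R) xi (fun w => rotate s (xi w))
    (fun z => (f (Phi z))%:E)) => //.
  - exact: cylinderI.
  - exact: cylinderT.
  - move=> A cA; rewrite /m /= /mrestr.
    transitivity (P (xi @^-1` A) * P D)%E.
      by apply: indep; exact: measurable_cylinder_borel.
    rewrite -(law_rotate s cA); apply/esym/indep.
    exact: (measurable_cylinder_borel (cylinder_rotate s cA)).
  - by move=> z; rewrite lee_fin.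
have step2 s : (\int[P]_w (f (turn s (xi w 0)))%:E = \int[P]_w (f (xi w 0))%:E)%E.
  apply/esym; apply: (@ge0_eq_integral_comp _ _ Omega T R P (@cylinder R) xi (fun w => rotate s (xi w))
    (fun z => (f (z 0))%:E)) => //.
  - exact: cylinderI.
  - exact: cylinderT.
  - by rewrite -ge0_fin_numE// fin_num_measure.
  - by move=> A cA; apply/esym/law_rotate.
  - by move=> z; rewrite lee_fin.
rewrite ge0_integral_restr//; last 2 first.
- exact: (measurableT_comp mg mxi).
- by move=> w; rewrite lee_fin.
(* The angle of [step1] is averaged over the value of [xi] at 0 in an independent copy. *)
transitivity (\int[P]_w' \int[m]_w (f (turn (circle_val (xi w' 0)) (Phi (xi w))))%:E)%E.
  rewrite -[LHS]mule1 -[in LHS](@probability_setT _ _ _ P) -integral_cst//.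
  by apply: eq_integral => w' _; exact: step1.
have mF : measurable_fun [set: Omega * Omega] (fun p : Omega * Omega =>
    (f (turn (circle_val (xi p.1 0)) (Phi (xi p.2))))%:E).
  apply/measurable_EFinP; apply: (measurableT_comp mf).
  apply: measurable_circle_shift.
    exact: (measurableT_comp (measurableT_comp mPhi mxi) measurable_snd).
  apply: (measurableT_comp (@measurable_circle_val R)).
  exact: (measurableT_comp (measurableT_comp (@measurable_coord R 0) mxi) measurable_fst).
have := @fubini_tonelli _ _ _ _ _ P (mrestr P mD) _ mF (fun p => _).
rewrite /= => ->; last by move=> p; rewrite lee_fin.
(* For fixed w the inner integral rotates a uniform opinion by a fixed angle, which [step2]
   removes. *)
transitivity (\int[m]_w (\int[P]_w' (f (xi w' 0))%:E))%E.
  apply: eq_integral => w _; rewrite -(step2 (circle_val (Phi (xi w)))).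
  by apply: eq_integral => w' _; rewrite turn_valC.
by rewrite integral_cst// /m /= /mrestr setTI.
Qed.

End uniform.

(** The index of a coin counts rings in a prefix of the pattern, so it is at most the length of the
    pattern. *)
Lemma eq_evolve (R : realType) (mu : R) (b b' : int -> nat -> bool) r xs i (z : config R) :
  (forall u k, u \in window r -> (k <= size xs)%N -> b u k = b' u k) ->
  all (mem (letters r)) xs -> (i <= size xs)%N ->
  evolve mu b xs i z = evolve mu b' xs i z.
Proof.
move=> bb hxs; elim: i => [//|i IH] hi /=; rewrite IH 1?ltnW//.
have : nth None xs i \in letters r by apply: (allP hxs); exact: mem_nth.
case: nth => [x|//] hx /=; rewrite bb//.
  by move: hx; rewrite inE/= mem_map// => ? ? [].
by apply: (leq_trans (count_size _ _)); rewrite size_take_min geq_minr.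
Qed.

Lemma mutual_indep_setI d (Omega : measurableType d) (R : realType)
    (P : probability Omega R) (I : choiceType) (F : I -> set_system Omega)
    (J : {fset I}) (A : I -> set Omega) (i0 : I) :
  mutual_indep P F -> i0 \notin J -> F i0 (A i0) -> (forall i, i \in J -> F i (A i)) ->
  P (A i0 `&` \bigcap_(i in [set` J]) A i) = (P (A i0) * P (\bigcap_(i in [set` J]) A i))%E.
Proof.
move=> indep i0J F0 FJ; rewrite (indep J)//.
rewrite -[RHS](@big_fsetU1 _ _ _ _ i0 J (fun i => P (A i)))//= -indep.
  congr (P _); apply/seteqP; split => w.
    by move=> [h0 h] i /=; rewrite in_fset1U => /orP[/eqP->//|]; exact: h.
  move=> h; split; first by apply: h; rewrite /= in_fset1U eqxx.
  by move=> i hi; apply: h; rewrite /= in_fset1U hi orbT.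
by move=> i; rewrite in_fset1U => /orP[/eqP->//|]; exact: FJ.
Qed.

(** * Splitting the probability space by rings and coins *)

Section pieces.
Context (R : realType) d (Omega : measurableType d) (P : probability Omega R).
Context (N : int -> R -> {RV P >-> nat}) (b : int -> nat -> {RV P >-> bool}).
Context (xi : {RV P >-> borel (config R)}).
Hypothesis clocks : forall v, poisson_process 1 (N v).
Hypothesis indep : mutual_indep P (driving_sigma N b xi).
Variables (r J : nat) (g : nat -> R) (tau : R).
Hypotheses (g_ge0 : 0 <= g 0%N) (g_nd : nondecreasing_seq g).
Hypotheses (tau_gt0 : 0 < tau) (gS : forall i, g i.+1 - g i = tau).

(** The coins that J steps can consult: an edge of the window rings at most once per step. *)
Let C : {fset int * nat} := [fset c in [seq (v, k) | v <- window r, k <- iota 0 J.+1]]%fset.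

(* The second component of an index is the set of the coins showing [true]. *)
Definition piece (i : seq (option int) * {fset int * nat}) : set Omega :=
  pattern_event N r g i.1 `&`
  \bigcap_(c in [set` C]) [set w | b c.1 c.2 w = (c \in i.2)].

(** One family of conditions indexed by the sources, so that the independence of a piece and the
    initial configuration becomes an instance of [mutual_indep]. *)
Definition piece_cond (A : set Omega) (i : seq (option int) * {fset int * nat}) (s : unit + int + int * nat) : set Omega :=
  match s with
  | inl (inl _) => A
  | inl (inr u) => clock_event N g i.1 u
  | inr c => [set w | b c.1 c.2 w = (c \in i.2)]
  end.

Lemma pieceE A i : piece i =
  \bigcap_(s in [set` ([fset inl (inr u) | u in window r] `|` [fset inr c | c in C])%fset])
    piece_cond A i s.
Proof.
rewrite /piece pattern_eventE; apply/seteqP; split => w.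
  move=> [h1 h2] s /=; rewrite in_fsetU => /orP[] /imfsetP[x /= hx ->] /=.
    by apply: h1; rewrite /= inE.
  exact: h2.
move=> h; split => u /= hu.
  by apply: (h (inl (inr u))); rewrite /= in_fsetU in_imfset//=; move: hu; rewrite inE.
by apply: (h (inr u)); rewrite /= in_fsetU (in_imfset _ (@inr _ _))// orbT.
Qed.

Lemma piece_indep (A : set (borel (config R))) i : measurable A ->
  (P (xi @^-1` A `&` piece i) = P (xi @^-1` A) * P (piece i))%E.
Proof.
move=> mA; rewrite (pieceE (xi @^-1` A) i).
apply: (mutual_indep_setI (i0 := inl (inl tt)) indep) => /=.
- by apply/negP; rewrite in_fsetU => /orP[] /imfsetP[].
- by exists A => //; rewrite setTI.
move=> s; rewrite in_fsetU => /orP[] /imfsetP[x /= hx ->] /=.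
  exact: clock_event_sigma.
case: x hx => v k _ /=; exists [set (v, k) \in i.2 : bool] => //.
by rewrite setTI.
Qed.

Lemma measurable_piece i : measurable (piece i).
Proof.
apply: measurableI; first exact: measurable_pattern_event.
apply: fin_bigcap_measurable; first exact: finite_fset.
move=> c _; rewrite -[X in measurable X]setTI.
exact: (measurable_funPT (b c.1 c.2) measurableT [set (c \in i.2 : bool)]).
Qed.

(** Provides the walls of [eta_evolve] around site 0: a silent edge among -r, ..., -1 and one among
    0, ..., r - 1. *)
Definition gapped (xs : seq (option int)) : bool :=
  has (fun k => Some (- k.+1%:Z) \notin xs) (iota 0 r) &&
  has (fun k => Some k%:Z \notin xs) (iota 0 r).

Definition piece_indices : seq (seq (option int) * {fset int * nat}) :=
  [seq (xs, D) | xs <- [seq xs <- patterns r J | gapped xs], D <- fpowerset C].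

Lemma uniq_piece_indices : uniq piece_indices.
Proof.
apply: allpairs_uniq.
- by rewrite filter_uniq// uniq_patterns.
- exact: fset_uniq.
- by move=> [x y] [x' y'] _ _ /= [-> ->].
Qed.

Lemma trivIset_piece : trivIset [set` piece_indices] piece.
Proof.
move=> i j /allpairsP[[xs D] /= [hxs hD ->]] /allpairsP[[ys E] /= [hys hE ->]].
move=> [w [[/= px cx] [/= py cy]]].
move: hxs hys; rewrite !mem_filter => /andP[_ hxs] /andP[_ hys].
have -> : xs = ys by apply: (@trivIset_pattern_event _ _ _ _ N r g J) => //; exists w.
congr (_, _); apply/fsetP => c.
move: hD hE; rewrite !fpowersetE => hD hE.
have [cC|cC] := boolP (c \in C); first by rewrite -(cx c cC) -(cy c cC).
have /negPf -> : c \notin D by apply/negP => /(fsubsetP hD); exact/negP.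
by apply/esym/negPf/negP => /(fsubsetP hE); exact/negP.
Qed.

(** The pattern [nseq J None] means silence in all steps, so this is the event that every edge of
    [s] rings. *)
Definition busy (s : seq int) : set Omega :=
  \bigcap_(u in [set` [fset u in s]%fset]) ~` clock_event N g (nseq J None) u.

Lemma measure_busy s : uniq s ->
  P (busy s) = ((1 - expR (- (J%:R * tau))) ^+ size s)%:E.
Proof.
move=> us.
pose unidx (i : unit + int + int * nat) : int := if i is inl (inr u) then u else 0.
have -> : busy s = \bigcap_(i in [set` [fset (inl (inr u) : unit + int + int * nat) | u in s]%fset])
    ~` clock_event N g (nseq J None) (unidx i).
  apply/seteqP; split => w h.
    by move=> _ /= /imfsetP[u /= hu ->]; apply: h; rewrite /= inE.
  by move=> u /=; rewrite inE => hu; apply: (h (inl (inr u))); exact: in_imfset.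
rewrite indep; last first.
  move=> _ /= /imfsetP[u /= hu ->] /=.
  apply: (@measurableC _ (g_sigma_algebraType _)); exact: clock_event_sigma.
rewrite (perm_big [seq (inl (inr u) : unit + int + int * nat) | u <- s]); last first.
  apply: uniq_perm; first exact: fset_uniq.
    by rewrite map_inj_uniq// => ? ? [].
  by move=> i; apply/imfsetP/mapP => -[u hu ->]; exists u.
rewrite big_map/=.
transitivity (\prod_(u <- s) (1 - expR (- (J%:R * tau)))%:E)%E.
  apply: eq_bigr => u _; rewrite probability_setC; last first.
    by apply: (@sigma_of_process_measurable _ _ _ _ (N u)); exact: clock_event_sigma.
  rewrite (measure_clock_event g_ge0 g_nd clocks _ _ tau_gt0 gS) -EFinB; congr (1 - _)%:E.
  rewrite size_nseq (eq_bigr (fun=> expR (- tau))); last first.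
    move=> i _; rewrite nth_nseq ltn_ord /poisson_pmf tau_gt0 expr0 fact0.
    by rewrite invr1 !mul1r.
  by rewrite prodr_const card_ord -mulNr mulrC -expRM_natr mulNr mulrN.
by rewrite prodEFin big_const_seq count_predT iter_mulr_1.
Qed.

Let to_left : seq int := [seq - k.+1%:Z | k <- iota 0 r].
Let to_right : seq int := [seq k%:Z | k <- iota 0 r].

Lemma pattern_event_busy xs w (s : seq int) : size xs = J ->
  pattern_event N r g xs w -> {subset s <= window r} ->
  (forall u, u \in s -> Some u \in xs) -> busy s w.
Proof.
move=> sx hw sr hs u /=; rewrite inE => us h.
have := nth_index None (hs u us); set i := index _ _ => ei.
have hi : (i < size xs)%N by rewrite index_mem hs.
have := hw u i (sr u us) hi; rewrite ei eqxx.
have -> : (N u (g i.+1) w - N u (g i) w)%N = (nth None (nseq J None) i == Some u).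
  by apply: h; rewrite /= inE mem_iota size_nseq -sx.
by rewrite nth_nseq -sx hi.
Qed.

(** A pattern that is not gapped has a ring at every edge of one side. For a gapped pattern, the
    coins read off from the outcome select a piece that contains it. *)
Lemma setC_pieces_sub :
  ~` (\big[setU/set0]_(i <- piece_indices) piece i) `<=`
  ~` (\big[setU/set0]_(xs <- patterns r J) pattern_event N r g xs) `|`
    (busy to_left `|` busy to_right).
Proof.
move=> w h; have [|] := pselect ((\big[setU/set0]_(xs <- patterns r J) pattern_event N r g xs) w); last by left.
rewrite -bigcup_seq => -[xs /= hxs hw]; right.
have sx : size xs = J by move: hxs; rewrite patternsP => /andP[/eqP].
have [gx|] := boolP (gapped xs).
  exfalso; apply: h; rewrite -bigcup_seq.
  pose D : {fset int * nat} := [fset c in C | b c.1 c.2 w]%fset.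
  exists (xs, D).
    apply/allpairsP; exists (xs, D); split => //=; first by rewrite mem_filter gx.
    by rewrite fpowersetE; apply/fsubsetP => c; rewrite !inE => /andP[].
  split => // c /= hc.
  have -> : (c \in D) = (c \in C) && b c.1 c.2 w by rewrite /D !inE.
  by rewrite hc.
rewrite negb_and -!all_predC => /orP[] /allP hall; [left|right];
  apply: (pattern_event_busy sx hw) => u /mapP[k kr ->].
- by rewrite mem_window; move: kr; rewrite mem_iota; clear; lia.
- by have := hall k kr; rewrite /= negbK.
- by rewrite mem_window; move: kr; rewrite mem_iota; clear; lia.
- by have := hall k kr; rewrite /= negbK.
Qed.

Lemma measurable_busy s : measurable (busy s).
Proof.
apply: fin_bigcap_measurable; first exact: finite_fset.
move=> u _; apply: measurableC.
by apply: (@sigma_of_process_measurable _ _ _ _ (N u)); exact: clock_event_sigma.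
Qed.

Lemma measure_setC_all_pieces :
  (P (~` \big[setU/set0]_(i <- piece_indices) piece i) <=
  (J%:R * (tau * (2 * r + 3)%:R) ^+ 2 + 2 * (1 - expR (- (J%:R * tau))) ^+ r)%:E)%E.
Proof.
have mU (I : eqType) (s : seq I) (A : I -> set Omega) : (forall i, measurable (A i)) ->
    measurable (~` \big[setU/set0]_(i <- s) A i).
  by move=> mA; apply: measurableC; apply: bigsetU_measurable.
have mp := measurable_pattern_event N r g_ge0 g_nd.
have mb : measurable (busy to_left `|` busy to_right).
  by apply: measurableU; exact: measurable_busy.
have m1 := mU _ (patterns r J) _ mp.
apply: (@le_trans _ _ (P (~` (\big[setU/set0]_(xs <- patterns r J) pattern_event N r g xs) `|`
    (busy to_left `|` busy to_right)))).
  apply: le_measure setC_pieces_sub; rewrite inE; first by apply: mU; exact: measurable_piece.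
  exact: measurableU.
apply: (le_trans (measureU2 _ _ _)) => //; rewrite EFinD; apply: leeD.
  have Pxs xs : xs \in patterns r J -> P (pattern_event N r g xs) =
      (pattern_weight (expR (- (tau * (2 * r + 3)%:R))) tau xs)%:E.
    rewrite patternsP => /andP[_ hxs].
    exact: (measure_pattern_event g_ge0 g_nd clocks indep).
  have PU := measure_setC_pieces (uniq_patterns _ _) mp (@trivIset_pattern_event _ _ _ _ N r g J) Pxs.
  have := one_sub_average1_le r J (ltW tau_gt0); rewrite /average.
  under [X in 1 - X]eq_bigr do rewrite mulr1.
  by rewrite -lee_fin -PU.
apply: (le_trans (measureU2 _ _ _)); try exact: measurable_busy.
have Pb s : uniq s -> size s = r -> P (busy s) = ((1 - expR (- (J%:R * tau))) ^+ r)%:E.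
  by move=> us <-; exact: measure_busy.
rewrite mulr2n mulrDl mul1r EFinD; apply: leeD.
  rewrite -(Pb to_left)// ?size_map ?size_iota// map_inj_uniq ?iota_uniq//.
  by move=> k l; clear; lia.
rewrite -(Pb to_right)// ?size_map ?size_iota// map_inj_uniq ?iota_uniq//.
by move=> k l; clear; lia.
Qed.

End pieces.

(** * The law of the opinion at 0 *)

Section marginal.
Context (R : realType) (mu : R) d (Omega : measurableType d) (P : probability Omega R).
Context (N : int -> R -> {RV P >-> nat}) (b : int -> nat -> {RV P >-> bool}).
Context (eta : R -> {RV P >-> borel (config R)}).
Hypothesis model : compass_model mu N b eta.
Hypothesis eta0_uniform : iid_uniform P (eta 0).

Lemma piece_evolve r J g i w : g 0%N = 0 -> nondecreasing_seq g ->
  regular mu N b eta w -> i \in piece_indices r J -> piece N b r J g i w ->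
  eta (g J) w 0 = evolve mu (fun v k => (v, k) \in i.2) i.1 J (eta 0 w) 0.
Proof.
move=> g0 gnd reg; rewrite /piece_indices => /allpairsP[[xs D] /= [hxs _ ->]] [/= px cx].
move: hxs; rewrite mem_filter => /andP[/andP[/hasP[a ar axs] /hasP[c cr cxs]]].
rewrite patternsP => /andP[/eqP sx hx].
have [clock n0 path] := reg.
rewrite mem_iota in ar; rewrite mem_iota in cr.
have gge0 : 0 <= g 0%N by rewrite g0.
have fit := pattern_event_fits gge0 gnd reg px.
have aw : - a.+1%:Z \in window r by rewrite mem_window; move: ar; clear; lia.
have cw : c%:Z \in window r by rewrite mem_window; move: cr; clear; lia.
have := eta_evolve (eta := fun t => eta t w) clock path gge0 gnd fit aw cw axs cxs (i := J) (v := 0).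
rewrite g0 => ->.
- rewrite (@eq_evolve _ _ _ (fun v k => (v, k) \in D) r)// ?sx// => u k hu hk.
  apply: (cx (u, k)).
  change (is_true ((u, k) \in [fset c in [seq (v, k) | v <- window r, k <- iota 0 J.+1]]%fset)).
  rewrite inE; apply/allpairsP; exists (u, k); split => //.
  by rewrite mem_iota add0n ltnS.
- by move=> u _; exact: n0.
- by rewrite sx.
- by rewrite oppr_lt0 ltz_nat.
Qed.

(** On every piece the opinion at 0 is an equivariant function of the initial configuration, so f
    minus its initial mean c integrates to 0 there; only the complement of the pieces
    contributes. *)
Lemma marginal_law t (f : circle R -> R) (M : R) : 0 <= t ->
  continuous f -> (forall z, 0 <= f z <= M) ->
  (\int[P]_w (f (eta t w 0))%:E = \int[P]_w (f (eta 0 w 0))%:E)%E.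
Proof.
rewrite le_eqVlt => /predU1P[<-//|t0] cf fM.
have f0 z : 0 <= f z by have /andP[] := fM z.
have fleM z : f z <= M by have /andP[] := fM z.
have M0 : 0 <= M := le_trans (f0 point) (fleM point).
have mf := continuous_borel_measurable cf.
have meta s : measurable_fun setT (fun w => f (eta s w 0)).
  exact: (measurableT_comp (measurableT_comp mf (@measurable_borel_coord R 0)) (measurable_funPT (eta s))).
have integrable_bounded (D : set Omega) (h : Omega -> R) : measurable D ->
    measurable_fun setT h -> (forall w, 0 <= h w <= M) -> P.-integrable D (EFin \o h).
  move=> mD mh hM; apply: measurable_bounded_integrable => //.
  - by rewrite -ge0_fin_numE// fin_num_measure.
  - exact: measurable_funTS.
  - exists M; split; first exact: num_real.
    move=> y My w _ /=; have /andP[h0 h1] := hM w.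
    by rewrite ger0_norm// (le_trans h1)// ltW.
have ifin s : (\int[P]_w (f (eta s w 0))%:E)%E \is a fin_num.
  by apply: integrable_fin_num => //; exact: integrable_bounded.
pose c := fine (\int[P]_w (f (eta 0 w 0))%:E)%E.
have cE : (\int[P]_w (f (eta 0 w 0))%:E = c%:E)%E by rewrite fineK.
have c0 : 0 <= c by apply: fine_ge0; apply: integral_ge0 => w _; rewrite lee_fin.
have cM : c <= M.
  rewrite -lee_fin -cE -[leRHS]mule1 -(@probability_setT _ _ _ P) -integral_cst//.
  by apply: ge0_le_integral => //= *; rewrite ?lee_fin//; apply/measurable_EFinP.
pose X w := f (eta t w 0) - c.
have mX : measurable_fun setT X by exact: measurable_funB.
have XM w : `|X w| <= M.
  by rewrite /X ler_norml; apply/andP; have := f0 (eta t w 0); have := fleM (eta t w 0); split; lra.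
have minus (D : set Omega) (h : Omega -> R) : measurable D ->
    measurable_fun setT h -> (forall w, 0 <= h w <= M) ->
    (\int[P]_(w in D) (h w - c)%:E = \int[P]_(w in D) (h w)%:E - c%:E * P D)%E.
  move=> mD mh hM; rewrite -integral_cst//.
  have ic : P.-integrable D (EFin \o cst c).
    by apply: integrable_bounded => // _ /=; rewrite c0.
  exact: (integralB_EFin mD (integrable_bounded D h mD mh hM) ic).
suff X0 (e : R) : 0 < e -> (`|\int[P]_w (X w)%:E| <= e%:E)%E.
  have XE : (\int[P]_w (X w)%:E = \int[P]_w (f (eta t w 0))%:E - c%:E)%E.
    by rewrite minus// probability_setT mule1.
  rewrite cE; move: (ifin t) X0; rewrite XE; case: (\int[P]_w (f (eta t w 0))%:E)%E => // z _ X0.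
  congr EFin; apply/eqP; rewrite -subr_eq0 -normr_eq0 eq_le normr_ge0 andbT.
  by apply/ler_addgt0Pl => e /X0; rewrite addr0 -EFinB lee_fin.
move=> e0.
(* The radius comes first: it makes it unlikely that all r edges of one side ring before time t. *)
have [r rP] : exists r : nat, M * (2 * (1 - expR (- t)) ^+ r) <= e / 2.
  have x1 : `|1 - expR (- t)| < 1.
    rewrite ger0_norm ?subr_ge0 ?expR_le1 ?oppr_le0 ?(ltW t0)//.
    by rewrite ltrBlDr ltrDl expR_gt0.
  have d0 : 0 < e / (4 * (M + 1)) by rewrite divr_gt0// mulr_gt0// ltr_wpDl.
  have /cvgrPdist_lt/(_ _ d0)[r _ /(_ r (leqnn _))] := cvg_expr x1.
  rewrite /= sub0r normrN => /ltW hr; exists r.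
  have hr' : (1 - expR (- t)) ^+ r <= e / (4 * (M + 1)) := le_trans (ler_norm _) hr.
  rewrite ler_pdivlMr in hr'; last by rewrite mulr_gt0// ltr_wpDl.
  have p0 : 0 <= (1 - expR (- t)) ^+ r.
    by rewrite exprn_ge0// subr_ge0 expR_le1 oppr_le0 ltW.
  move: p0 hr'; set p := _ ^+ r => p0 hr'.
  by have : 0 <= M * p := mulr_ge0 M0 p0; lra.
(* The number J of steps is then chosen in terms of r, so that the steps with several rings cost at
   most K / J. *)
pose K : R := M * (t * (2 * r + 3)%:R) ^+ 2.
pose J := (Num.truncn (2 * K / e)).+1.
have JK : 2 * K / e < J%:R by exact: truncnS_gt.
have J0 : 0 < J%:R :> R by rewrite ltr0n.
pose tau := t / J%:R.
have tau0 : 0 < tau by rewrite divr_gt0.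
pose g i : R := i%:R * tau.
have g0 : g 0%N = 0 by rewrite /g mul0r.
have gge0 : 0 <= g 0%N by rewrite g0.
have gS i : g i.+1 - g i = tau by rewrite /g -natr1; ring.
have gnd : nondecreasing_seq g.
  by move=> i j ij; rewrite ler_wpM2r ?ler_nat// ltW.
have Jt : J%:R * tau = t by rewrite /tau mulrC divfK// gt_eqF.
have gJ : g J = t by [].
have clocks := compass_clocks model.
have indep := compass_indep model.
have PU := measure_setC_all_pieces clocks indep r J gge0 gnd tau0 gS.
have mp i : measurable (piece N b r J g i) by exact: measurable_piece.
have tp : trivIset [set` piece_indices r J] (piece N b r J g) by exact: trivIset_piece.
apply: (le_trans (abs_integral_pieces (c := fun=> 0) (uniq_piece_indices r J) mp tp mX M0 XM PU _)).
  move=> i hi.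
  pose Phi (z : config R) : circle R := evolve mu (fun v k => (v, k) \in i.2) i.1 J z 0.
  have mPhi := measurable_evolve mu (fun v k => (v, k) \in i.2) i.1 J 0.
  have equiv s z : Phi (rotate s z) = turn s (Phi z) by rewrite /Phi evolve_rotate.
  have mPhiw : measurable_fun setT (fun w => f (Phi (eta 0 w))).
    exact: (measurableT_comp (measurableT_comp mf mPhi) (measurable_cylinder_fun (eta 0))).
  rewrite [X in `|X|%E](_ : _ = (\int[P]_(w in piece N b r J g i) (f (Phi (eta 0 w)) - c)%:E)%E).
    rewrite minus//.
    rewrite (integral_equivariant eta0_uniform (mp i) _ mPhi equiv cf f0).
      by rewrite cE subee ?abse0// fin_numM// fin_num_measure.
    by move=> A mA; exact: piece_indep.
  apply: ae_eq_integral => //.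
  - by apply/measurable_EFinP; exact: measurable_funTS.
  - by apply/measurable_EFinP; apply: measurable_funTS; exact: measurable_funB.
  apply: filterS (ae_regular model) => w reg hw; congr (_ - _)%:E.
  by rewrite /Phi -(piece_evolve g0 gnd reg hi hw) gJ.
rewrite lee_fin big1// add0r Jt mulrDr.
have : M * (J%:R * (tau * (2 * r + 3)%:R) ^+ 2) <= e / 2.
  rewrite [leLHS](_ : _ = K / J%:R); last by rewrite /K /tau; field; rewrite gt_eqF.
  by rewrite ler_pdivrMr//; move: JK; rewrite ltr_pdivrMr//; lra.
by lra.
Qed.

End marginal.

(** * Continuous functions near the constant configurations *)

Section near_consensus.
Context (R : realType).

Lemma cvg_config (F : set_system (config R)) (FF : Filter F) (z : config R) :
  (forall v, (fun x : config R => x v) @ F --> z v) -> F --> z.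
Proof.
move=> h; apply/cvg_sup => v; apply/cvg_image.
  by rewrite eqEsubset; split => x // _; exists (fun=> x).
move=> W /(h v) FW; exists ((fun x : config R => x v) @^-1` W) => //.
by rewrite eqEsubset; split => [x [y + <-//]|x Wx]; exists (fun=> x).
Qed.

Definition close_to (s : R) (n : nat) (z : config R) :=
  forall v : int, `|v| <= n%:Z -> circle_dist (z v) (circle_of s) < n.+1%:R^-1.

(** Continuity at each constant configuration gives a bound near each s; compactness of the segment
    makes it uniform. *)
Lemma uniform_near_consensus (f : config R -> R) (eps : R) : continuous f -> 0 < eps ->
  exists n : nat, forall (s : R) z, -1 <= s <= 1 -> close_to s n z ->
  `|f z - f (const_config s)| < eps.
Proof.
move=> cf eps0.
have /compact_near_coveringP/(_ nat \oo (fun n s => forall z, close_to s n z ->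
  `|f z - f (const_config s)| < eps)) := @segment_compact R (-1) 1.
move=> [|n _ /(_ n (leqnn n)) h]; last first.
  by exists n => s z hs; apply: h; rewrite /= in_itv.
move=> s _.
(* The radius is twice that of [close_to]: one half for the distance from z to s', the other for
   that from s' to s. *)
pose B n : set (config R) :=
  [set z | forall v : int, `|v| <= n%:Z -> circle_dist (z v) (circle_of s) < 2 / n.+1%:R].
have Bmono n m : (n <= m)%N -> B m `<=` B n.
  move=> nm z hz v hv; apply: (@lt_le_trans _ _ (2 / m.+1%:R)).
    by apply: hz; apply: (le_trans hv); rewrite lez_nat.
  by rewrite ler_pM2l// lef_pV2 ?posrE ?ltr0n// ler_nat.
pose F : set_system (config R) := filter_from setT B.
have FF : Filter F.
  apply: filter_from_filter; first by exists 0%N.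
  move=> i j _ _; exists (maxn i j) => //.
  by move=> z hz; split; apply: Bmono hz; rewrite ?leq_maxl ?leq_maxr.
have Fcvg : F --> (const_config s : config R).
  apply: (cvg_config FF) => v; apply/cvg_ballP => e e0.
  pose n := maxn `|v|%N (Num.truncn (2 / e)).
  exists n => // z /(_ v) hz; rewrite /= ballEmdist; change (circle_dist (circle_of s) (z v) < e); rewrite circle_distC.
  apply: (lt_trans (hz _)).
    by rewrite /n -abszE lez_nat leq_maxl.
  rewrite ltr_pdivrMr ?ltr0n// mulrC -ltr_pdivrMr//.
  by apply: (lt_le_trans (truncnS_gt _)); rewrite ler_nat ltnS leq_maxr.
have e2 : 0 < eps / 2 by rewrite divr_gt0.
have [n _ hn] : F [set z | `|f (const_config s) - f z| < eps / 2].
  by apply: Fcvg; move/cvgrPdist_lt: (cf (const_config s)); apply.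
near=> s' m => z hz.
have ss' : `|s - s'| < n.+1%:R^-1.
  by near: s'; apply/nbhs_ballP; exists n.+1%:R^-1 => //=; rewrite invr_gt0 ltr0n.
have nm : (n <= m)%N by near: m; exists n.
have h1 : B n z.
  move=> v hv; apply: (le_lt_trans (circle_dist_triangle (circle_of s') _ _)).
  rewrite mulrDl mul1r; apply: ltrD.
    apply: (@lt_le_trans _ _ m.+1%:R^-1).
      by apply: hz; apply: (le_trans hv); rewrite lez_nat.
    by rewrite lef_pV2 ?posrE ?ltr0n// ler_nat.
  by apply: (le_lt_trans (circle_dist_of _ _)); rewrite distrC.
have h2 : B n (const_config s').
  move=> v hv; rewrite /const_config; apply: (le_lt_trans (circle_dist_of _ _)).
  rewrite distrC; apply: (lt_trans ss').
  by rewrite ltr_pMl ?invr_gt0 ?ltr0n// ltr1n.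
have := hn _ h1; have := hn _ h2; rewrite /= => a1 a2.
apply: (le_lt_trans (ler_distD (f (const_config s)) _ _)).
by rewrite [X in X + _]distrC [ltRHS]splitr ltrD.
Unshelve. all: by end_near. Qed.

(** Triangle inequality along the at most n edges between v and 0. *)
Lemma circle_dist_chain (z : config R) (n : nat) (m : R) (v : int) :
  (forall u, u \in window n -> circle_dist (z u) (z (u + 1)) <= m) ->
  `|v| <= n%:Z -> circle_dist (z v) (z 0) <= n%:R * m.
Proof.
move=> hm hv.
have m0 : 0 <= m.
  by apply: le_trans (hm 0 _); rewrite ?circle_dist_ge0// mem_window normr0.
have pos (k : nat) (a : int) : (k <= n)%N -> (forall i, (i < k)%N -> a + i%:Z \in window n) ->
    circle_dist (z a) (z (a + k%:Z)) <= n%:R * m.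
  move=> kn ha; apply: (@le_trans _ _ (k%:R * m)); last by rewrite ler_wpM2r// ler_nat.
  elim: k {kn} ha => [|k IH] ha; first by rewrite addr0 circle_distxx mul0r.
  apply: (le_trans (circle_dist_triangle (z (a + k%:Z)) _ _)).
  rewrite -natr1 mulrDl mul1r; apply: lerD; first by apply: IH => i ik; exact/ha/ltnW.
  by rewrite (_ : a + k.+1%:Z = a + k%:Z + 1) ?hm ?ha//; clear; lia.
have [v0|v0] := leP 0 v.
  have -> : circle_dist (z v) (z 0) = circle_dist (z 0) (z (0 + `|v|%N)).
    by rewrite circle_distC; congr (circle_dist _ (z _)); clear -v0; lia.
  apply: pos; first by clear -hv; lia.
  by move=> i hi; rewrite mem_window; clear -hi hv; lia.
have -> : circle_dist (z v) (z 0) = circle_dist (z v) (z (v + `|v|%N)).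
  by congr (circle_dist _ (z _)); clear -v0; lia.
apply: pos; first by clear -hv; lia.
by move=> i hi; rewrite mem_window; clear -hi hv v0; lia.
Qed.

End near_consensus.

Section bounded_integral.
Context (R : realType) d (Omega : measurableType d) (P : probability Omega R).

Lemma bounded_integrable (h : Omega -> R) (M : R) : measurable_fun setT h ->
  (forall w, `|h w| <= M) -> P.-integrable setT (EFin \o h).
Proof.
move=> mh hM; apply: measurable_bounded_integrable => //.
  by rewrite -ge0_fin_numE// fin_num_measure.
exists M; split; first exact: num_real.
by move=> y My w _ /=; rewrite (le_trans (hM w))// ltW.
Qed.

Lemma integral_probability_cst (c : R) : (\int[P]_w (cst c w)%:E = c%:E)%E.
Proof. by rewrite -[RHS]mule1 -(@probability_setT _ _ _ P) -integral_cst. Qed.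

End bounded_integral.

(** * The weak limit *)

Section weak_limit.
Context (R : realType) (mu : R) (mu_gt0 : 0 < mu) (mu_le : mu <= 2^-1).
Context d (Omega : measurableType d) (P : probability Omega R).
Context (N : int -> R -> {RV P >-> nat}) (b : int -> nat -> {RV P >-> bool}).
Context (eta : R -> {RV P >-> borel (config R)}).
Hypothesis model : compass_model mu N b eta.
Hypothesis eta0_uniform : iid_uniform P (eta 0).

Let spr t u w : R := spread (fun t => eta t w) t u.

Definition total_spread n t w : R := \sum_(u <- window n) spr t u w.

Lemma spreads_vanish (s : seq int) (e : R) : 0 < e -> exists T : nat,
  forall u t, u \in s -> T%:R <= t -> (\int[P]_w (spr t u w)%:E <= e%:E)%E.
Proof.
move=> e0; elim: s => [|u s [T IH]]; first by exists 0%N.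
have [T' hT'] := spread_vanish mu_gt0 mu_le model u e0.
exists (maxn T T') => v t; rewrite inE => /predU1P[->|vs] Tt.
  apply: le_trans (lee_abs _) (hT' t _).
  by apply: le_trans Tt; rewrite ler_nat leq_maxr.
by apply: IH => //; apply: le_trans Tt; rewrite ler_nat leq_maxl.
Qed.

Lemma measurable_total_spread n t : measurable_fun setT (total_spread n t).
Proof. by apply: measurable_sum => u; exact: measurable_spread. Qed.

Lemma total_spread_ge0 n t w : 0 <= total_spread n t w.
Proof. by apply: sumr_ge0 => u _; exact: circle_dist_ge0. Qed.

Definition small_spread n delta t : set Omega := [set w | total_spread n t w < delta].

Lemma measurable_small_spread n delta t : measurable (small_spread n delta t).
Proof.
rewrite (_ : small_spread _ _ _ = total_spread n t @^-1` `]-oo, delta[).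
  by rewrite -[X in measurable X]setTI; exact: measurable_total_spread.
by apply/seteqP; split => w /=; rewrite in_itv.
Qed.

(** Markov's inequality for the sum of the 2 n + 3 distances, each of mean at most delta e / L for
    large t. *)
Lemma total_spread_small n (delta e : R) : 0 < delta -> 0 < e -> exists T : nat,
  forall t, T%:R <= t -> (P (~` small_spread n delta t) <= e%:E)%E.
Proof.
move=> delta0 e0; pose L : R := (2 * n + 3)%:R.
have L0 : 0 < L by rewrite ltr0n addn3.
have [T hT] := @spreads_vanish (window n) (delta * e / L) (divr_gt0 (mulr_gt0 delta0 e0) L0).
exists T => t Tt; have mS := measurable_total_spread n t.
have mA := measurableC (measurable_small_spread n delta t).
rewrite -(@lee_pmul2l _ delta%:E)// -EFinM -integral_cst//.
apply: (@le_trans _ _ (\int[P]_w (total_spread n t w)%:E)%E).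
  apply: (@le_trans _ _ (\int[P]_(w in ~` small_spread n delta t) (total_spread n t w)%:E)%E).
    apply: ge0_le_integral => //=.
    - by move=> w _; rewrite lee_fin ltW.
    - by apply/measurable_EFinP; exact: measurable_funTS.
    - by move=> w /negP; rewrite /small_spread /= -leNgt lee_fin.
  apply: ge0_subset_integral => //.
  - exact/measurable_EFinP.
  - by move=> w _; rewrite lee_fin total_spread_ge0.
rewrite /total_spread.
under eq_integral do rewrite -sumEFin.
rewrite ge0_integral_sum//; last 2 first.
- by move=> u; apply/measurable_EFinP; exact: measurable_spread.
- by move=> u w _; rewrite lee_fin circle_dist_ge0.
apply: (@le_trans _ _ (\sum_(u <- window n) (delta * e / L)%:E)%E).
  by rewrite big_seq [leRHS]big_seq; apply: lee_sum => u hu; exact: hT.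
rewrite sumEFin lee_fin big_const_seq count_predT size_window iter_addr_0.
by rewrite -[leLHS]mulr_natr divfK// gt_eqF.
Qed.

Variables (f : config R -> R) (M : R).
Hypotheses (f_cont : continuous f) (f_le : forall z, `|f z| <= M).

Let f1 (z : circle R) : R := f (fun=> z).

Let M_ge0 : 0 <= M.
Proof. exact: le_trans (normr_ge0 _) (f_le point). Qed.

Let f1_cont : continuous f1.
Proof.
move=> z; apply: (@continuous_comp _ _ _ (fun z : circle R => (fun=> z) : config R) f).
  by apply: (cvg_config (fmap_filter _ (nbhs_filter z))) => v; exact: cvg_id.
exact: f_cont.
Qed.

Let measurable_f t : measurable_fun setT (fun w => f (eta t w)).
Proof.
exact: (measurableT_comp (continuous_borel_measurable f_cont) (measurable_funPT (eta t))).
Qed.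

Let measurable_f1 t : measurable_fun setT (fun w => f1 (eta t w 0)).
Proof.
exact: (measurableT_comp (measurableT_comp (continuous_borel_measurable f1_cont)
  (@measurable_borel_coord R 0)) (measurable_funPT (eta t))).
Qed.

Let if1 t : P.-integrable setT (EFin \o (fun w => f1 (eta t w 0))).
Proof. by apply: (@bounded_integrable _ _ _ _ _ M) => // w; exact: f_le. Qed.

Let if_ t : P.-integrable setT (EFin \o (fun w => f (eta t w))).
Proof. by apply: (@bounded_integrable _ _ _ _ _ M) => // w; exact: f_le. Qed.

(** [marginal_law] concerns nonnegative functions, hence the shift by M, undone at the end. *)
Lemma integral_marginal t : 0 <= t ->
  (\int[P]_w (f1 (eta t w 0))%:E = \int[P]_w (f1 (eta 0 w 0))%:E)%E.
Proof.
move=> t0.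
have icM : P.-integrable setT (EFin \o (cst M : Omega -> R)).
  by apply: (@bounded_integrable _ _ _ _ _ `|M|).
have shift s : (\int[P]_w (f1 (eta s w 0) + M)%:E = \int[P]_w (f1 (eta s w 0))%:E + M%:E)%E.
  by rewrite -(integral_probability_cst P) -(integralD_EFin measurableT (if1 s) icM).
have : (\int[P]_w (f1 (eta t w 0) + M)%:E = \int[P]_w (f1 (eta 0 w 0) + M)%:E)%E.
  apply: (@marginal_law R mu d Omega P N b eta model eta0_uniform t
    (fun z => f1 z + M) (M + M)) => //.
    by move=> z; apply: (@continuousD _ _ _ f1 (cst M)); [exact: f1_cont|exact: cst_continuous].
  move=> z; have := f_le (fun=> z); rewrite ler_norml -/(f1 z) => /andP[h1 h2].
  by apply/andP; split; lra.
rewrite !shift => /(congr1 (fun x => x - M%:E)%E).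
by rewrite !addeK.
Qed.

(** Where the window is nearly in consensus, the configuration is compared with the constant one
    having its value at 0; elsewhere the difference is at most 2 M. *)
Lemma abs_integral_sub_le (e : R) : 0 < e -> exists T : nat, forall t, T%:R <= t ->
  (`|\int[P]_w (f (eta t w) - f1 (eta t w 0))%:E| <= e%:E)%E.
Proof.
move=> e0; have e2 : 0 < e / 2 by rewrite divr_gt0.
have [n hn] := uniform_near_consensus f_cont e2.
(* A chain of at most n edges then costs less than n delta < 1 / (n + 1), as [close_to] requires. *)
pose delta : R := (n.+1%:R ^+ 2)^-1.
have delta0 : 0 < delta by rewrite invr_gt0 exprn_gt0.
have M40 : 0 < 4 * (M + 1) by rewrite mulr_gt0// ltr_wpDl.
have [T hT] := total_spread_small n delta0 (divr_gt0 e0 M40).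
exists T => t Tt.
pose A (_ : unit) := small_spread n delta t.
have mA i : measurable (A i) by exact: measurable_small_spread.
have mX : measurable_fun setT (fun w => f (eta t w) - f1 (eta t w 0)).
  exact: measurable_funB.
apply: (le_trans (@abs_integral_pieces _ _ _ P _ [:: tt] A (fun=> e / 2) _ (2 * M)
  (e / (4 * (M + 1))) _ mA _ mX _ _ _ _)) => //.
- by move=> [] [].
- by rewrite mulr_ge0.
- move=> w; apply: (le_trans (ler_normB _ _)).
  by rewrite mulr2n mulrDl mul1r; apply: lerD; exact: f_le.
- by rewrite big_seq1; exact: hT.
- move=> i _.
  have mXA : measurable_fun (A i) (EFin \o (fun w => f (eta t w) - f1 (eta t w 0))).
    by apply/measurable_EFinP; exact: measurable_funTS.
  apply: (le_trans (le_abse_integral _ (mA i) mXA)).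
  apply: (le_trans (@integral_le_bound _ _ _ P _ _ (e / 2)%:E (mA i) mXA _ _)).
  + by rewrite lee_fin ltW.
  + apply: aeW => w hw /=; rewrite lee_fin ltW//.
    have := hn (circle_val (eta t w 0)) (eta t w).
    rewrite (_ : f (const_config _) = f1 (eta t w 0)); last first.
      by congr f; apply/funext => v; rewrite /const_config circle_valK.
    apply; first by have /andP[/ltW -> ->] := circle_valP (eta t w 0).
    move=> v hv; rewrite circle_valK.
    apply: (@le_lt_trans _ _ (n%:R * total_spread n t w)).
      apply: circle_dist_chain hv => u hu.
      rewrite /total_spread (bigD1_seq u) ?uniq_window//= lerDl.
      by apply: sumr_ge0 => k _; exact: circle_dist_ge0.
    apply: (@le_lt_trans _ _ (n%:R * delta)).
      by rewrite ler_wpM2l// ltW.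
    rewrite /delta expr2 invfM mulrA -[ltRHS]mul1r ltr_pM2r ?invr_gt0//.
    by rewrite ltr_pdivrMr// mul1r ltr_nat.
  + rewrite -[leRHS]mule1; apply: lee_wpmul2l; first by rewrite lee_fin ltW.
    exact: probability_le1.
rewrite lee_fin big_seq1 mulrA.
have : 2 * M * e / (4 * (M + 1)) <= e / 2.
  rewrite ler_pdivrMr//.
  by have : 0 <= M * e := mulr_ge0 M_ge0 (ltW e0); lra.
by lra.
Qed.

(** The mixture is the law of the constant configuration whose value is the initial opinion at 0. *)
Lemma integral_mixture :
  (\int[@consensus_mixture R]_z (f z)%:E = \int[P]_w (f1 (eta 0 w 0))%:E)%E.
Proof.
pose phi (w : Omega) : borel (config R) := const_config (circle_val (eta 0 w 0)).
have mcoord : measurable_fun setT (fun w => eta 0 w 0 : borel (circle R)).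
  exact: (measurableT_comp (@measurable_borel_coord R 0) (measurable_funPT (eta 0))).
have mphi : measurable_fun setT phi.
  apply: (measurableT_comp (@measurable_const_config R)).
  exact: (measurableT_comp (@measurable_circle_val R) mcoord).
have phiE w : f (phi w) = f1 (eta 0 w 0).
  by congr f; apply/funext => v; rewrite /phi /const_config circle_valK.
have mf : measurable_fun [set: borel (config R)] (EFin \o f).
  by apply/measurable_EFinP; exact: continuous_borel_measurable.
have iphi : P.-integrable (phi @^-1` setT) ((EFin \o f) \o phi).
  rewrite preimage_setT; apply: (@bounded_integrable _ _ _ _ (f \o phi) M).
    exact: (measurableT_comp (continuous_borel_measurable f_cont) mphi).
  by move=> w; exact: f_le.
transitivity (\int[P]_w ((EFin \o f) \o phi) w)%E; last first.
  by apply: eq_integral => w _; rewrite /= phiE.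
have := @integral_pushforward _ _ Omega (borel (config R)) R phi mphi P setT
  (EFin \o f) mf iphi measurableT.
rewrite preimage_setT => <-.
apply: eq_measure_integral => A mA _.
have mC : measurable (@const_config R @^-1` A).
  by rewrite -[X in measurable X]setTI; exact: measurable_const_config.
case: eta0_uniform => _ /(_ 0 _ mC); rewrite /pushforward => uA.
transitivity (2^-1%:E * lebesgue_measure ((@const_config R @^-1` A) `&` `](-1)%R, 1%R]))%E; last first.
  exact/esym.
rewrite /consensus_mixture/=; congr (_ * _)%E.
rewrite -integral_indic//.
Qed.

Lemma cvg_integral :
  (\int[distribution P (eta t)]_z (f z)%:E)%E @[t --> +oo] -->
  (\int[@consensus_mixture R]_z (f z)%:E)%E.
Proof.
have mf : measurable_fun [set: borel (config R)] (EFin \o f).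
  by apply/measurable_EFinP; exact: continuous_borel_measurable.
pose e t := fine (\int[P]_w (f (eta t w))%:E)%E.
have eE t : (\int[P]_w (f (eta t w))%:E = (e t)%:E)%E.
  by rewrite /e fineK//; exact: (integrable_fin_num measurableT (if_ t)).
pose l := fine (\int[P]_w (f1 (eta 0 w 0))%:E)%E.
have lE : (\int[P]_w (f1 (eta 0 w 0))%:E = l%:E)%E.
  by rewrite /l fineK//; exact: (integrable_fin_num measurableT (if1 0)).
rewrite integral_mixture lE.
rewrite (_ : (fun t => _) = EFin \o e); last first.
  by apply/funext => t; rewrite /= -eE; exact: (integral_distribution mf (if_ t)).
apply: cvg_EFin; first exact: nearW.
apply/cvgrPdist_le => eps eps0.
have [T hT] := abs_integral_sub_le eps0.
exists T%:R; split; first exact: num_real.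
move=> t /ltW Tt /=.
have := hT t Tt.
have -> : (\int[P]_w (f (eta t w) - f1 (eta t w 0))%:E)%E = (e t - l)%:E.
  rewrite EFinB -eE -lE -(integral_marginal (le_trans (ler0n _ _) Tt)).
  exact: (integralB_EFin measurableT (if_ t) (if1 t)).
by rewrite distrC.
Qed.

End weak_limit.

Theorem corollary1p3 (R : realType) (mu : R) (mu_gt0 : 0 < mu)
    (mu_le : mu <= 2^-1)
    (d : measure_display) (Omega : measurableType d) (P : probability Omega R)
    (N : int -> R -> {RV P >-> nat}) (b : int -> nat -> {RV P >-> bool})
    (eta : R -> {RV P >-> borel (config R)}) :
  compass_model mu N b eta ->
  iid_uniform P (eta 0) ->
  weak_cvg +oo (fun t => distribution P (eta t)) (@consensus_mixture R).
Proof.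
move=> model unif f cf [M [_ hM]].
(* [bounded_fun] bounds f by every number strictly above M, whence M + 1. *)
apply: (@cvg_integral _ _ mu_gt0 mu_le _ _ _ _ _ _ model unif f (M + 1) cf) => z.
by apply: hM => //; rewrite ltrDl.
Qed.
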